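(* Let $d\ge 2$ and $n\ge 1$ be integers and let $c>0$, $t>0$ be real. Let $\underline{\mathbf X}_d(t)$ be the position at time $t$ of the random flight in $\mathbb{R}^d$ with parameter $\nu=1$, speed $c$ and $n$ changes of direction in $[0,t]$ (as defined in the context). Then for every $\underline\alpha_d=(\alpha_1,\dots,\alpha_d)\in\mathbb{R}^d$ (at $\underline\alpha_d=0$ the right-hand side is understood as its limit), $$E\left\{e^{i\langle\underline\alpha_d,\underline{\mathbf X}_d(t)\rangle}\right\}=\frac{\sqrt{\pi}\,\Gamma((n+1)(d+1))}{2^{\frac{(d+1)(n+1)-1}{2}}}\sum_{j=0}^{n+1}(-1)^{n+1-j}\binom{n+1}{j}\frac{\left(\frac{\alpha_d^2}{\|\underline\alpha_d\|^2}\,\frac{d+1}{2}\right)^{n+1-j}}{\Gamma\!\left(\frac{(n+1)(d+3)}{2}-j\right)}\;\frac{J_{\frac{(n+1)(d+3)-(2j+1)}{2}}(ct\|\underline\alpha_d\|)}{(ct\|\underline\alpha_d\|)^{\frac{(n+1)(d-1)+2j-1}{2}}}.$$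
   Context: Here $\langle\cdot,\cdot\rangle$ and $\|\cdot\|$ are the Euclidean scalar product and norm, and $J_\mu(x)=\sum_{k=0}^\infty\frac{(-1)^k}{k!\,\Gamma(k+\mu+1)}\left(\frac x2\right)^{2k+\mu}$ is the Bessel function. Random flight with $\nu=1$. A particle starts at the origin of $\mathbb{R}^d$, moves with constant speed $c>0$, and changes direction exactly $n$ times in $[0,t]$. The durations of the $n+1$ straight segments are $\tau_1,\dots,\tau_{n+1}>0$ with $\tau_{n+1}=t-\sum_{j=1}^n\tau_j$, and $(\tau_1,\dots,\tau_n)$ has the rescaled Dirichlet density $$f_{d,1}(\tau_1,\dots,\tau_n)=\frac{\Gamma((n+1)(d+1))}{(\Gamma(d+1))^{n+1}}\,\frac{\prod_{k=1}^{n+1}\tau_k^{d}}{t^{(n+1)(d+1)-1}}$$ on $\{\tau_j>0\ (1\le j\le n),\ \sum_{j=1}^n\tau_j<t\}$. The angle vectors $(\theta_{1,k},\dots,\theta_{d-2,k},\phi_k)$, $k=1,\dots,n+1$, are independent of each other and of the times, and each has density $$g_{d,1}(\theta_1,\dots,\theta_{d-2},\phi)=\frac{\Gamma(1+d/2)}{2\pi^{\frac{d-1}{2}}\Gamma(3/2)}\sin^{d}\theta_1\,\sin^{d-1}\theta_2\cdots\sin^{3}\theta_{d-2}\,\sin^{2}\phi$$ on $\theta_j\in[0,\pi]$ $(1\le j\le d-2)$, $\phi\in[0,2\pi]$ (for $d=2$ there is only the angle $\phi$). The position $\underline{\mathbf X}_d(t)=(X_1(t),\dots,X_d(t))$ is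 given, with the convention $\theta_{d-1,k}=\phi_k$, by $$X_i(t)=c\sum_{k=1}^{n+1}\tau_k\,\sin\theta_{1,k}\cdots\sin\theta_{i-1,k}\,\cos\theta_{i,k}\quad(1\le i\le d-1),\qquad X_d(t)=c\sum_{k=1}^{n+1}\tau_k\,\sin\theta_{1,k}\cdots\sin\theta_{d-2,k}\,\sin\phi_k.$$ *)

(* Defs.v *)
From HB Require Import structures.
From mathcomp Require Import all_boot all_order all_algebra.
From mathcomp Require Import all_classical all_reals all_analysis.
From mathcomp Require Import complex.

Set Implicit Arguments.
Unset Strict Implicit.
Unset Printing Implicit Defensive.
Import Order.TTheory GRing.Theory Num.Theory.
Import numFieldNormedType.Exports.

Local Open Scope classical_set_scope.
Local Open Scope ring_scope.

Section special_functions.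
Context {R : realType}.

(* Euler's integral: the value is the Gamma function only for x > 0. *)
Definition Gamma (x : R) : R :=
  \int[lebesgue_measure]_(s in `]0, +oo[) (s `^ (x - 1) * expR (- s)).

(* The real power and Gamma restrict the meaningful range to x > 0, mu > -1. *)
Definition BesselJ (mu x : R) : R :=
  limn (series (fun k : nat =>
    (-1) ^+ k / (k`!%:R * Gamma (k%:R + mu + 1)) * (x / 2) `^ (2 * k%:R + mu))).

End special_functions.

(* Lebesgue measure on R^n, with R^n the type n.-tuple R and its product
   sigma-algebra. The library's [lebesgue_measure] lives on [measurableTypeR R],
   a copy of R with another display but the same measurable sets. *)
Section lebesgue_measure_tuple.
Context {R : realType}.

Definition tuple_cons n (p : measurableTypeR R * n.-tuple R) : n.+1.-tuple R :=
  [tuple of p.1 :: p.2].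

Lemma measurable_tuple_cons n :
  measurable_fun [set: measurableTypeR R * n.-tuple R] (@tuple_cons n).
Proof.
apply: (@measurable_cons _ _ (measurableTypeR R * n.-tuple R)%type R
  (fun p => p.1) n (fun p => p.2)).
- exact: (@measurable_fst _ _ (measurableTypeR R) (n.-tuple R)).
- exact: measurable_snd.
Qed.

Section cons_measure.
Local Open Scope ereal_scope.
Variables (n : nat) (m : {sigma_finite_measure set (n.-tuple R) -> \bar R}).

Definition cons_measure : set (n.+1.-tuple R) -> \bar R :=
  pushforward (lebesgue_measure \x m) (@tuple_cons n).

Let cons_measure0 : cons_measure set0 = 0.
Proof. by rewrite /cons_measure /pushforward preimage_set0 measure0. Qed.

Let cons_measure_ge0 A : 0 <= cons_measure A.
Proof. by rewrite /cons_measure /pushforward; exact: measure_ge0. Qed.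

Let cons_measure_sigma_additive : semi_sigma_additive cons_measure.
Proof.
move=> F mF tF mUF; rewrite /cons_measure /pushforward preimage_bigcup.
apply: measure_semi_sigma_additive.
- by move=> k; rewrite -[X in measurable X]setTI; exact: measurable_tuple_cons.
- apply/trivIsetP => /= i j _ _ ij; rewrite -preimage_setI.
  by move/trivIsetP : tF => /(_ _ _ _ _ ij) ->//; rewrite preimage_set0.
- rewrite -preimage_bigcup -[X in measurable X]setTI.
  exact: measurable_tuple_cons.
Qed.

HB.instance Definition _ := isMeasure.Build _ _ _ cons_measure
  cons_measure0 cons_measure_ge0 cons_measure_sigma_additive.

Let cons_measure_sigma_finite : sigma_finite setT cons_measure.
Proof.
have [F TF Foo] : sigma_finite setT (lebesgue_measure \x m).
  have /sigma_finiteP[F [TF ndF Foo]] := sigma_finiteT (@lebesgue_measure R).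
  have /sigma_finiteP[G [TG ndG Goo]] := sigma_finiteT m.
  exists (fun k => F k `*` G k).
    rewrite -setXTT TF TG predeqE => -[x y]; split.
      move=> [/= [i _ Fix] [j _ Gjy]]; exists (maxn i j) => //; split.
      - by move: x Fix; exact/subsetPset/ndF/leq_maxl.
      - by move: y Gjy; exact/subsetPset/ndG/leq_maxr.
    by move=> [i _ []/= ? ?]; split; exists i.
  move=> k; have [? ?] := Foo k; have [? ?] := Goo k.
  split; first exact: measurableX.
  by rewrite product_measure1E// lte_mul_pinfty// ge0_fin_numE.
pose g (x : n.+1.-tuple R) : measurableTypeR R * n.-tuple R :=
  (thead x, [tuple of behead x]).
have mg : measurable_fun [set: n.+1.-tuple R] g.
  apply: measurable_fun_pair; first exact: (@measurable_tnth _ R n.+1 ord0).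
  exact: measurable_behead.
have gK x : tuple_cons (g x) = x by rewrite [RHS]tuple_eta; exact/val_inj.
have Kg p : g (tuple_cons p) = p.
  by case: p => x v; congr pair; apply/val_inj.
exists (fun k => g @^-1` F k).
  by rewrite -preimage_bigcup -TF preimage_setT.
move=> k; have [mFk Fkoo] := Foo k; split.
  by rewrite -[X in measurable X]setTI; exact: mg.
rewrite /cons_measure /pushforward -comp_preimage (_ : g \o @tuple_cons n = id)//.
exact/funext.
Qed.

HB.instance Definition _ := Measure_isSigmaFinite.Build _ _ _ cons_measure
  cons_measure_sigma_finite.

End cons_measure.

Fixpoint lebesgue_tuple n : {sigma_finite_measure set (n.-tuple R) -> \bar R} :=
  match n with
  | 0 => \d_([tuple] : 0.-tuple R)
  | n'.+1 => cons_measure (lebesgue_tuple n')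
  end.

End lebesgue_measure_tuple.

Section probability_notions.
Context {d} {T : measurableType d} {R : realType} (P : probability T R).

Definition has_density n (X : {RV P >-> n.-tuple R}) (f : n.-tuple R -> R) : Prop :=
  forall A : set (n.-tuple R), measurable A ->
    distribution P X A = (\int[lebesgue_tuple n]_(x in A) (f x)%:E)%E.

Definition sigma_of d' (T' : measurableType d') (X : T -> T') : set_system T :=
  preimage_set_system setT X measurable.

Definition mutually_independent (I : finType) (F : I -> set_system T) : Prop :=
  forall (J : {set I}) (A : I -> set T), (forall i, i \in J -> F i (A i)) ->
    P (\bigcap_(i in [set` J]) A i) = (\prod_(i in J) P (A i))%E.

Definition cexpectation (Z : T -> R[i]) : R[i] :=
  Complex (\int[P]_w complex.Re (Z w)) (\int[P]_w complex.Im (Z w)).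

End probability_notions.

Definition expi {R : realType} (y : R) : R[i] := Complex (cos y) (sin y).

(* The library's norm on row vectors is the sup norm. *)
Definition dot {R : realType} d (u v : 'rV[R]_d) : R := \sum_(i < d) u 0 i * v 0 i.
Definition enorm {R : realType} d (u : 'rV[R]_d) : R := Num.sqrt (dot u u).

Section random_flight.
Context {R : realType}.

(* The last entry is tau_(n+1) = t - (tau_1 + ... + tau_n). *)
Definition durations (t : R) n (s : n.-tuple R) : n.+1.-tuple R :=
  [tuple of rcons s (t - \sum_(j < n) tnth s j)].

Definition times_density d n (t : R) (s : n.-tuple R) : R :=
  if [forall j, 0 < tnth s j] && (\sum_(j < n) tnth s j < t) then
    Gamma (n.+1 * d.+1)%:R / Gamma d.+1%:R ^+ n.+1 *
    ((\prod_(k < n.+1) tnth (durations t s) k ^+ d) / t ^+ (n.+1 * d.+1).-1)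
  else 0.

(* The d - 1 angles (theta_1, ..., theta_(d-2), phi) are indexed from 0: the
   angle of index i is theta_(i+1), whose sine has exponent d - i, and the last
   one, of index d - 2, is phi, with exponent 2 and range [0, 2 pi]. *)
Definition angle_bound d (i : 'I_d.-1) : R :=
  if val i == (d - 2)%N then 2 * pi else pi.

Definition angles_density d (th : (d.-1).-tuple R) : R :=
  if [forall i, 0 <= tnth th i <= angle_bound i] then
    Gamma (1 + d%:R / 2) / (2 * pi `^ ((d%:R - 1) / 2) * Gamma (3 / 2)) *
    \prod_(i < d.-1) sin (tnth th i) ^+ (d - i)
  else 0.

Definition direction d (th : (d.-1).-tuple R) : 'rV[R]_d :=
  \row_(i < d) ((\prod_(m < d.-1 | (m < i)%N) sin (tnth th m)) *
    (if (i < d.-1)%N then cos th`_i else 1)).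

Section flight.
Context {dT} {T : measurableType dT} (P : probability T R).

(* The constraints on the durations and on the ranges of the angles are carried
   by the supports of the densities, hence hold almost surely. *)
Record random_flight d n (t : R) (tau : {RV P >-> n.-tuple R})
    (theta : 'I_n.+1 -> {RV P >-> (d.-1).-tuple R}) : Prop := RandomFlight {
  flight_times : has_density tau (times_density d t) ;
  flight_angles : forall k, has_density (theta k) (@angles_density d) ;
  flight_independent : mutually_independent P (fun i : option 'I_n.+1 =>
    if i is Some k then sigma_of (theta k) else sigma_of tau) }.

Definition position d n (c t : R) (tau : {RV P >-> n.-tuple R})
    (theta : 'I_n.+1 -> {RV P >-> (d.-1).-tuple R}) (w : T) : 'rV[R]_d :=
  c *: \sum_(k < n.+1) tnth (durations t (tau w)) k *: direction (theta k w).

End flight.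

Lemma pred_lt_dim d : (2 <= d)%N -> (d.-1 < d)%N.
Proof. by case: d. Qed.

Definition last_ord d (hd : (2 <= d)%N) : 'I_d := Ordinal (pred_lt_dim hd).

(* At alpha = 0 the formula involves divisions by 0 and its Rocq value is
   meaningless. The power with exponent 0 is 1, also when alpha_d = 0. *)
Definition flight_cf d (hd : (2 <= d)%N) n (c t : R) (alpha : 'rV[R]_d) : R :=
  let r := enorm alpha in
  Num.sqrt pi * Gamma (n.+1 * d.+1)%:R
    / 2 `^ ((d.+1%:R * n.+1%:R - 1) / 2) *
  \sum_(j < n.+2)
    (-1) ^+ (n.+1 - j) * 'C(n.+1, j)%:R *
    ((alpha 0 (last_ord hd) ^+ 2 / r ^+ 2 * (d.+1%:R / 2)) ^+ (n.+1 - j)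
      / Gamma (n.+1%:R * (d%:R + 3) / 2 - j%:R)) *
    (BesselJ ((n.+1%:R * (d%:R + 3) - (2 * j%:R + 1)) / 2) (c * t * r)
      / (c * t * r) `^ ((n.+1%:R * (d%:R - 1) + 2 * j%:R - 1) / 2)).

End random_flight.

(* Main.v *)
Require Import Defs.
From HB Require Import structures.
From mathcomp Require Import all_boot all_order all_algebra.
From mathcomp Require Import all_classical all_reals all_analysis.
From mathcomp Require Import measurable_realfun complex ring zify.
Set Implicit Arguments.
Unset Strict Implicit.
Unset Printing Implicit Defensive.
Import Order.TTheory GRing.Theory Num.Theory.
Import numFieldNormedType.Exports.
Local Open Scope classical_set_scope.
Local Open Scope ring_scope.

(** Why the formula holds. Write [r = |alpha|^2], [a = alpha_d^2],
    [kappa = (d + 1) / 2], [A = (n + 1) (d + 1) - 1], and let [Z] be the scalar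
    product of [alpha] with the position. All the moments of [Z] are computed; the
    characteristic function is then summed from its power series.

    Directions. The angle density is proportional to the product of the squares of
    all the sines times the density of the surface measure, so a direction [u] has
    a law proportional to [u_d^2] times the surface measure. The moments of
    [<alpha, u>] are obtained by integrating one angle at a time, from the
    recursion [angle_moment_rec] in the dimension and the trigonometric Beta
    integrals [trig_even_cos]. The odd ones vanish; the even ones, up to factors
    depending only on the order [2 k] and on [d], are
    [r^k / k! + 2 a r^(k-1) / (k-1)!] ([angle_moment_closed],
    [direction_moments]). The normalising constant of the density is never
    evaluated: the moment of order 0 is 1.

    Durations. Their density is a monomial on a simplex, and so is its product with
    a monomial in the durations. Their joint moments are therefore given by
    Dirichlet's integral ([dirichlet_integral], [duration_moments]).

    Position. By independence ([independent_expectation_prod]) and the multinomial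
    theorem ([multinomial_expansion]), [E Z^K / K!] is [(c t)^K A! / (A + K)!]
    times a sum, over the ways to write [K] as a sum of [n + 1] numbers, of products
    of one factor for each displacement, that is, a coefficient of the
    [(n + 1)]-st power of a generating function. By Legendre's duplication formula
    the even part of this function is, in the variable [z] of degree two,
    [(1 - r z)^(- kappa) (1 + 2 kappa a z / (1 - r z))] ([step_coef_even],
    [flight_moment]). The binomial theorem expands its [(n + 1)]-st power
    ([coef_projection_exp]), and this gives the [n + 2] terms of the sum over [j].

    Summation. For each [j], the duplication formula identifies the series in the
    moments as that of a Bessel function whose order is half of an integer
    ([cvg_cf_term]). The cosine series may be integrated term by term because the
    durations are almost surely positive, hence [Z] is almost surely bounded
    ([cvg_expectation_series]); the sine has expectation 0 since the odd moments
    vanish. At [alpha = 0] the expectation is 1, and this is the limit of the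
    right-hand side because [|cos z - 1| <= |z|] makes the expectation continuous
    there ([expectation_cos_cvg0]). *)

(** * Integration against a density *)

(** The measure with density [W] with respect to [mu]. *)
Definition weighted d (T : measurableType d) (R : realType)
    (mu : {measure set T -> \bar R}) (W : T -> R) of (forall x, 0 <= W x)
    & measurable_fun setT W := fun A : set T => (\int[mu]_(x in A) (W x)%:E)%E.

Section weighted.
Local Open Scope ereal_scope.
Context d (T : measurableType d) (R : realType) (mu : {measure set T -> \bar R}).
Variables (W : T -> R) (W0 : forall x, (0 <= W x)%R) (mW : measurable_fun setT W).

Let weighted0 : weighted mu W0 mW set0 = 0.
Proof. by rewrite /weighted integral_set0. Qed.

Let weighted_ge0 A : 0 <= weighted mu W0 mW A.
Proof. by apply: integral_ge0 => x _; rewrite lee_fin. Qed.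

Let weighted_sigma_additive : semi_sigma_additive (weighted mu W0 mW).
Proof.
move=> /= F mF tF mUF; rewrite /weighted; apply: cvg_toP.
  apply: ereal_nondecreasing_is_cvgn => m n mn.
  apply: lee_sum_nneg_natr => // k _ _; apply: integral_ge0 => /= x _.
  by rewrite lee_fin.
rewrite ge0_integral_bigcup//=; last by move=> x _; rewrite lee_fin.
by apply/measurable_EFinP; exact: measurable_funTS.
Qed.

HB.instance Definition _ := isMeasure.Build _ _ _ (weighted mu W0 mW)
  weighted0 weighted_ge0 weighted_sigma_additive.

Import HBNNSimple.

(** By monotone convergence from the simple functions. *)
Lemma ge0_integral_weighted (h : T -> \bar R) :
  measurable_fun setT h -> (forall x, 0 <= h x) ->
  \int[weighted mu W0 mW]_x h x = \int[mu]_x (h x * (W x)%:E).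
Proof.
move=> mh h0; pose f := nnsfun_approx measurableT mh.
have mWE : measurable_fun setT (EFin \o W) by exact/measurable_EFinP.
have mf n : measurable_fun setT (EFin \o f n).
  by apply/measurable_EFinP; exact: measurable_funP.
have indicf n r : measurable_fun setT (fun x => (r * \1_(f n @^-1` [set r]) x)%:E).
  by apply/measurable_EFinP; exact: measurable_funM.
have mono : {homo f : m n / (m <= n)%N >-> forall x, (m x <= n x)%R}.
  by move=> m n mn x; exact/lefP/nd_nnsfun_approx.
transitivity (limn (fun n => \int[weighted mu W0 mW]_x (f n x)%:E)).
  rewrite -monotone_convergence//.
  - by apply: eq_integral => x _; apply/esym/cvg_lim => //; exact: cvg_nnsfun_approx.
  - by move=> n x _; rewrite lee_fin.
  - by move=> x _ m n mn; rewrite lee_fin mono.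
transitivity (limn (fun n => \int[mu]_x ((f n x)%:E * (W x)%:E))); last first.
  rewrite -monotone_convergence//.
  - apply: eq_integral => x _; apply/cvg_lim => //; apply: cvgeZr => //.
    exact: cvg_nnsfun_approx.
  - by move=> n; apply: emeasurable_funM; [exact: mf|exact: mWE].
  - by move=> n x _; rewrite mule_ge0 ?lee_fin.
  - by move=> x _ m n mn; rewrite lee_wpmul2r ?lee_fin ?mono.
apply: congr_lim; apply/funext => n.
transitivity (\int[weighted mu W0 mW]_x
   (\sum_(y \in range (f n)) (y * \1_(f n @^-1` [set y]) x)%:E)).
  by apply: eq_integral => x _; rewrite /= fimfunE -fsumEFin.
rewrite ge0_integral_fsum//; last by move=> m y _; exact: nnfun_muleindic_ge0.
transitivity (\int[mu]_x (\sum_(y \in range (f n))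
    (y * \1_(f n @^-1` [set y]) x)%:E * (W x)%:E)); last first.
  apply: eq_integral => x _; rewrite -ge0_mule_fsuml => [|y]; last first.
    exact: nnfun_muleindic_ge0.
  by rewrite fsumEFin // -(fimfunE _ x).
rewrite ge0_integral_fsum//; last 2 first.
  - by move=> y; apply: emeasurable_funM; [exact: indicf|exact: mWE].
  - by move=> m y _; rewrite mule_ge0 ?lee_fin// -lee_fin nnfun_muleindic_ge0.
apply: eq_fsbigr => r /[!inE] -[t _ frt].
under eq_integral do rewrite EFinM.
rewrite integralZl_indic_nnsfun// integral_indic// setIT.
under [RHS]eq_integral do rewrite EFinM -muleA.
rewrite ge0_integralZl//; last 3 first.
  - by apply: emeasurable_funM => //; exact/measurable_EFinP.
  - by move=> x _; rewrite mule_ge0 ?lee_fin.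
  - by rewrite lee_fin -frt.
congr (_ * _); rewrite /= /weighted [LHS]integral_mkcond.
by apply: eq_integral => x _; rewrite epatch_indic muleC.
Qed.

End weighted.

Section transfer.
Local Open Scope ereal_scope.
Context d (S : measurableType d) (R : realType).
Context d1 (T1 : measurableType d1) (mu1 : {measure set T1 -> \bar R}).
Context d2 (T2 : measurableType d2) (mu2 : {measure set T2 -> \bar R}).
Variables (X1 : T1 -> S) (W1 : T1 -> R) (X2 : T2 -> S) (W2 : T2 -> R).
Hypotheses (mX1 : measurable_fun setT X1) (mX2 : measurable_fun setT X2).
Hypotheses (W1_ge0 : forall x, (0 <= W1 x)%R) (W2_ge0 : forall x, (0 <= W2 x)%R).
Hypotheses (mW1 : measurable_fun setT W1) (mW2 : measurable_fun setT W2).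
Hypothesis eqW : forall A, measurable A ->
  \int[mu1]_(x in X1 @^-1` A) (W1 x)%:E = \int[mu2]_(x in X2 @^-1` A) (W2 x)%:E.

(** Two weighted variables with the same distribution have the same weighted
    expectations. *)
Lemma ge0_integral_transfer (h : S -> \bar R) :
  measurable_fun setT h -> (forall y, 0 <= h y) ->
  \int[mu1]_x (h (X1 x) * (W1 x)%:E) = \int[mu2]_x (h (X2 x) * (W2 x)%:E).
Proof.
move=> mh h0.
have pushE d' (T : measurableType d') (mu : {measure set T -> \bar R})
    (X : T -> S) (W : T -> R)
    (W0 : forall x, (0 <= W x)%R) (mW : measurable_fun setT W) :
    measurable_fun setT X ->
    \int[mu]_x (h (X x) * (W x)%:E) = \int[pushforward (weighted mu W0 mW) X]_y h y.
  move=> mX; rewrite [RHS]ge0_integral_pushforward ?preimage_setT//.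
  rewrite (ge0_integral_weighted mu W0 mW (h := h \o X))//.
    exact: measurableT_comp.
  by move=> x; exact: h0.
rewrite (pushE _ _ mu1 X1 W1 W1_ge0 mW1 mX1) (pushE _ _ mu2 X2 W2 W2_ge0 mW2 mX2).
by apply: eq_measure_integral => A mA _; exact: eqW.
Qed.

Lemma integral_transfer (h : S -> R) : measurable_fun setT h ->
  mu1.-integrable setT (fun x => (h (X1 x) * W1 x)%:E) ->
  mu2.-integrable setT (fun x => (h (X2 x) * W2 x)%:E) ->
  \int[mu1]_x (h (X1 x) * W1 x)%:E = \int[mu2]_x (h (X2 x) * W2 x)%:E.
Proof.
move=> mh i1 i2; rewrite integralE [RHS]integralE.
have mhE : measurable_fun setT (EFin \o h) by exact/measurable_EFinP.
have posE T (X : T -> S) (W : T -> R) : (forall x, (0 <= W x)%R) ->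
    (fun x => (h (X x) * W x)%:E)^\+ = fun x => (EFin \o h)^\+ (X x) * (W x)%:E.
  move=> W0; apply/funext => x; rewrite !funeposE /= EFinM.
  by rewrite -[in LHS](mul0e (W x)%:E) maxe_pMl ?lee_fin.
have negE T (X : T -> S) (W : T -> R) : (forall x, (0 <= W x)%R) ->
    (fun x => (h (X x) * W x)%:E)^\- = fun x => (EFin \o h)^\- (X x) * (W x)%:E.
  move=> W0; apply/funext => x; rewrite !funenegE /=.
  transitivity (maxe ((- h (X x))%:E * (W x)%:E) 0); first by rewrite -EFinM mulNr.
  by rewrite -[in LHS](mul0e (W x)%:E) maxe_pMl ?lee_fin.
rewrite !posE// !negE//; congr (_ - _); apply: ge0_integral_transfer => //.
- exact: measurable_funepos.
- exact: measurable_funeneg.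
Qed.

End transfer.

(** * Expectations of bounded variables, independence *)

Section Rintegral_complements.
Context d (T : measurableType d) (R : realType) (mu : {measure set T -> \bar R}).

Lemma integrable_sum_EFin (I : Type) (s : seq I) (F : I -> T -> R) :
  (forall i, mu.-integrable setT (EFin \o F i)) ->
  mu.-integrable setT (EFin \o (fun x => \sum_(i <- s) F i x)).
Proof.
move=> iF; rewrite (_ : _ \o _ = fun x => (\sum_(i <- s) (EFin \o F i) x)%E).
  exact: integrable_sum.
by apply/funext => x; rewrite /= sumEFin.
Qed.

Lemma Rintegral_sum (I : Type) (s : seq I) (F : I -> T -> R) :
  (forall i, mu.-integrable setT (EFin \o F i)) ->
  \int[mu]_x (\sum_(i <- s) F i x) = \sum_(i <- s) \int[mu]_x F i x.
Proof.
move=> iF; elim: s => [|i s ih].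
  under eq_Rintegral do rewrite big_nil.
  by rewrite big_nil /Rintegral integral0.
under eq_Rintegral do rewrite big_cons.
by rewrite big_cons RintegralD ?ih//; exact: integrable_sum_EFin.
Qed.

Lemma Rintegral_mul_indic (A : set T) (f : T -> R) :
  \int[mu]_(x in A) f x = \int[mu]_x (f x * \1_A x).
Proof.
rewrite Rintegral_mkcond; apply: eq_Rintegral => x _.
by rewrite patchE indicE; case: (_ \in _); rewrite ?mulr1 ?mulr0.
Qed.

Lemma integrable_mul_indic (A : set T) (f : T -> R) : measurable A ->
  mu.-integrable A (EFin \o f) ->
  mu.-integrable setT (EFin \o (fun x => f x * \1_A x)).
Proof.
move=> mA; rewrite (integrable_mkcond _ mA); congr (_.-integrable _ _).
apply/funext => x; rewrite patchE /= indicE.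
by case: (_ \in _); rewrite ?mulr1 ?mulr0.
Qed.

End Rintegral_complements.

Section bounded_measurable.
Context d (T : measurableType d) (R : realType).
Implicit Types f g : T -> R.

(** Bounded measurable functions: an algebra of functions that are integrable
    for every probability. *)
Definition bmeas f := measurable_fun setT f /\ exists M, forall x, `|f x| <= M.

Lemma bmeas_cst (c : R) : bmeas (fun=> c).
Proof. by split; [exact: measurable_cst|exists `|c|]. Qed.

Lemma bmeasD f g : bmeas f -> bmeas g -> bmeas (fun x => f x + g x).
Proof.
move=> [mf [M fM]] [mg [N gN]]; split; first exact: measurable_funD.
by exists (M + N) => x; rewrite (le_trans (ler_normD _ _))// lerD.
Qed.

Lemma bmeasM f g : bmeas f -> bmeas g -> bmeas (fun x => f x * g x).
Proof.
move=> [mf [M fM]] [mg [N gN]]; split; first exact: measurable_funM.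
by exists (M * N) => x; rewrite normrM ler_pM.
Qed.

Lemma bmeasB f g : bmeas f -> bmeas g -> bmeas (fun x => f x - g x).
Proof.
move=> bf bg; rewrite (_ : (fun _ => _) = fun x => f x + -1 * g x).
  by apply: bmeasD => //; apply: bmeasM => //; exact: bmeas_cst.
by apply/funext => x; rewrite mulN1r.
Qed.

Lemma bmeas_sum (I : Type) (s : seq I) (p : pred I) (F : I -> T -> R) :
  (forall i, bmeas (F i)) -> bmeas (fun x => \sum_(i <- s | p i) F i x).
Proof.
move=> bF; elim: s => [|i s ih].
  by under eq_fun do rewrite big_nil; exact: bmeas_cst.
under eq_fun do rewrite big_cons.
by case: (p i) => //; exact: bmeasD.
Qed.

Lemma bmeas_prod (I : Type) (s : seq I) (p : pred I) (F : I -> T -> R) :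
  (forall i, bmeas (F i)) -> bmeas (fun x => \prod_(i <- s | p i) F i x).
Proof.
move=> bF; elim: s => [|i s ih].
  by under eq_fun do rewrite big_nil; exact: bmeas_cst.
under eq_fun do rewrite big_cons.
by case: (p i) => //; exact: bmeasM.
Qed.

Lemma bmeasX f n : bmeas f -> bmeas (fun x => f x ^+ n).
Proof.
move=> bf; elim: n => [|n ih]; first exact: bmeas_cst.
by under eq_fun do rewrite exprS; exact: bmeasM.
Qed.

Lemma bmeas_indic (A : set T) : measurable A -> bmeas (\1_A).
Proof.
move=> mA; split; first exact: measurable_indic.
by exists 1 => x; rewrite indicE; case: (_ \in _); rewrite ?normr1 ?normr0.
Qed.

Lemma bmeas_max0 f : bmeas f -> bmeas (fun x => Num.max (f x) 0).
Proof.
move=> [mf [M fM]]; split; first exact: measurable_maxr.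
exists M => x; rewrite (le_trans _ (fM x))//.
by case: (leP (f x) 0) => h; rewrite ?normr0.
Qed.

Variable P : probability T R.

Lemma bmeas_integrable f : bmeas f -> P.-integrable setT (EFin \o f).
Proof.
move=> [mf [M fM]]; apply: measurable_bounded_integrable => //.
  by apply: le_lt_trans (probability_le1 P measurableT) _; rewrite ltry.
by exists M; split; [exact: num_real|move=> r Mr x _; exact: le_trans (fM x) (ltW Mr)].
Qed.

Lemma Rintegral_indic (A : set T) : measurable A -> \int[P]_x (\1_A x) = fine (P A).
Proof. by move=> mA; rewrite /Rintegral integral_indic// setIT. Qed.

(** If [Z] has mean [c] given every event of the form [f \in B], it has mean [c]
    given [f]. *)
Lemma expectation_mul_cond (Z f : T -> R) (c : R) : bmeas Z -> bmeas f ->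
  (forall B, measurable B ->
    \int[P]_x (Z x * \1_(f @^-1` B) x) = c * fine (P (f @^-1` B))) ->
  \int[P]_x (Z x * f x) = c * \int[P]_x f x.
Proof.
move=> bZ bf ZB; pose W x := Z x - c.
(* the claim is that [W f] has mean 0; the positive and negative parts of [W],
   taken as weights, give the same distribution to [f] *)
have bW : bmeas W by apply: bmeasB => //; exact: bmeas_cst.
pose Wp x := Num.max (W x) 0; pose Wn x := Num.max (- W x) 0.
have bWp : bmeas Wp by exact: bmeas_max0.
have bWn : bmeas Wn.
  apply: bmeas_max0; rewrite (_ : (fun _ => _) = fun x => 0 - W x).
    by apply: bmeasB => //; exact: bmeas_cst.
  by apply/funext => x; rewrite sub0r.
have WE x : W x = Wp x - Wn x.
  rewrite /Wp /Wn; case: (leP (W x) 0) => h.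
    by rewrite max_l ?sub0r ?opprK// oppr_ge0.
  by rewrite max_r ?subr0// oppr_le0 ltW.
have fin_int g : bmeas g -> (\int[P]_x (g x)%:E = (\int[P]_x g x)%:E)%E.
  by move=> bg; rewrite fineK// integrable_fin_num//; exact: bmeas_integrable.
have eqW B : measurable B ->
    (\int[P]_(x in f @^-1` B) (Wp x)%:E = \int[P]_(x in f @^-1` B) (Wn x)%:E)%E.
  move=> mB.
  have mfB : measurable (f @^-1` B) by rewrite -[_ @^-1` _]setTI; exact: bf.1.
  have iB g : bmeas g -> P.-integrable (f @^-1` B) (EFin \o g).
    by move=> bg; apply: integrableS (bmeas_integrable bg).
  have fB g : bmeas g ->
      (\int[P]_(x in f @^-1` B) (g x)%:E = (\int[P]_(x in f @^-1` B) g x)%:E)%E.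
    by move=> bg; rewrite fineK// integrable_fin_num//; exact: iB.
  rewrite !fB//; congr EFin; apply/eqP; rewrite -subr_eq0 -RintegralB//; try exact: iB.
  under eq_Rintegral do rewrite -WE.
  rewrite Rintegral_mul_indic; under eq_Rintegral do rewrite mulrBl.
  have b1 := bmeas_indic mfB.
  rewrite RintegralB//; last 2 first.
  - by apply: bmeas_integrable; exact: bmeasM.
  - by apply: bmeas_integrable; apply: bmeasM => //; exact: bmeas_cst.
  by rewrite ZB// RintegralZl ?Rintegral_indic ?subrr//; exact: bmeas_integrable.
have Wp0 x : 0 <= Wp x by rewrite le_max lexx orbT.
have Wn0 x : 0 <= Wn x by rewrite le_max lexx orbT.
have := integral_transfer bf.1 bf.1 Wp0 Wn0 bWp.1 bWn.1 eqW (@measurable_id _ _ _)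
  (bmeas_integrable (bmeasM bf bWp)) (bmeas_integrable (bmeasM bf bWn)).
rewrite !fin_int; [|exact: bmeasM..] => transfer.
apply/eqP; rewrite -subr_eq0 -RintegralZl//; last exact: bmeas_integrable.
rewrite -RintegralB//; last 2 first.
- by apply: bmeas_integrable; exact: bmeasM.
- by apply: bmeas_integrable; apply: bmeasM => //; exact: bmeas_cst.
under eq_Rintegral do rewrite -mulrBl -/(W _) WE mulrC mulrBr.
rewrite RintegralB//; try by apply: bmeas_integrable; exact: bmeasM.
by rewrite subr_eq0; apply/eqP; exact: EFin_inj.
Qed.

(** Expectations of products of independent bounded variables factor. Independence
    is only used on events [f i \in B i]. *)
Lemma independent_expectation_prod (I : finType) (F : I -> set_system T)
    (f : I -> T -> R) : mutually_independent P F ->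
  (forall i A, F i A -> measurable A) ->
  (forall i B, measurable B -> F i (f i @^-1` B)) ->
  (forall i, bmeas (f i)) ->
  \int[P]_x (\prod_i f i x) = \prod_i \int[P]_x f i x.
Proof.
move=> indF mF Ff bf.
(* the variables are introduced one at a time in place of indicators *)
suff main (s : seq I) : uniq s -> forall A : I -> set T, (forall i, F i (A i)) ->
    \int[P]_x ((\prod_(i <- s) f i x) * \prod_(i | i \notin s) \1_(A i) x) =
    (\prod_(i <- s) \int[P]_x f i x) * \prod_(i | i \notin s) fine (P (A i)).
  have /= := main (index_enum I) (index_enum_uniq I) (fun i => f i @^-1` setT)
    (fun i => Ff i _ measurableT).
  under [X in _ = _ * X]eq_bigl do rewrite mem_index_enum.
  rewrite big_pred0_eq mulr1 => <-; apply: eq_Rintegral => x _.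
  under [X in _ = _ * X]eq_bigl do rewrite mem_index_enum.
  by rewrite big_pred0_eq mulr1.
elim: s => [_ A FA|i s ih /= /andP[nis us] A FA].
  under eq_Rintegral do rewrite big_nil mul1r.
  rewrite big_nil mul1r.
  have mI : measurable (\bigcap_(i in [set` [set: I]%SET]) A i).
    by apply: fin_bigcap_measurable => [|i _]; [exact: finite_finset|exact: mF (FA i)].
  transitivity (fine (P (\bigcap_(i in [set` [set: I]%SET]) A i))).
    rewrite -Rintegral_indic//; apply: eq_Rintegral => x _; rewrite indicE.
    have [Ax|] := pselect ((\bigcap_(i in [set` [set: I]%SET]) A i) x).
      rewrite mem_set//=; move: Ax.
      by move=> Ax; rewrite big1// => i _; rewrite indicE mem_set//; apply: Ax; rewrite /= inE.
    move=> nA; rewrite memNset//=; apply/eqP; rewrite prodf_seq_eq0.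
    have [i nAi] : exists i, ~ A i x.
      by apply: contrapT => h; apply: nA => i _; apply: contrapT => nAi; apply: h; exists i.
    apply/hasP; exists i; first exact: mem_index_enum.
    by rewrite indicE memNset//= eqxx.
  rewrite indF// (eq_bigr (fun i => (fine (P (A i)))%:E)); last first.
    by move=> i _; rewrite fineK// fin_num_measure//; exact: mF (FA i).
  by rewrite prodEFin; apply: eq_bigl => i; rewrite !inE.
(* [Z] is independent of [f i]: by the induction hypothesis, its mean on each
   event [f i \in B] is its mean times the probability of the event *)
pose Z x := (\prod_(j <- s) f j x) * \prod_(j | (j \notin s) && (j != i)) \1_(A j) x.
have bZ : bmeas Z.
  apply: bmeasM; first exact: bmeas_prod.
  by apply: bmeas_prod => j; apply: bmeas_indic; exact: mF (FA j).
have nsE j : (j \notin i :: s) = (j \notin s) && (j != i).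
  by rewrite inE negb_or andbC.
rewrite big_cons (eq_bigl _ _ nsE); under eq_Rintegral.
  move=> x _; rewrite big_cons -mulrA mulrC (eq_bigl _ _ nsE) -/(Z x); over.
rewrite (expectation_mul_cond (c := (\prod_(j <- s) \int[P]_x f j x) *
   \prod_(j | (j \notin s) && (j != i)) fine (P (A j))))//; first by ring.
move=> B mB; pose A' j := if j == i then f i @^-1` B else A j.
have FA' j : F j (A' j) by rewrite /A'; case: eqP => [->|//]; exact: Ff.
have A'i : A' i = f i @^-1` B by rewrite /A' eqxx.
have A'j j : (j \notin s) && (j != i) -> A' j = A j.
  by case/andP => _ ji; rewrite /A' (negbTE ji).
have A'E (g : set T -> R) : \prod_(j | (j \notin s) && (j != i)) g (A' j) =
    \prod_(j | (j \notin s) && (j != i)) g (A j).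
  by apply: eq_bigr => j hj; rewrite A'j.
have := ih us A' FA'; rewrite [in RHS](bigD1 i)//= A'i.
rewrite (A'E (fun B => fine (P B))).
rewrite mulrCA [RHS]mulrC => <-; apply: eq_Rintegral => x _.
rewrite [in RHS](bigD1 i)//= A'i /Z.
rewrite (A'E (fun B => \1_B x)).
by ring.
Qed.

End bounded_measurable.

(** * Iterated integrals over tuples *)

Section lebesgue_tuple.
Context {R : realType}.
Local Notation mu := (@lebesgue_measure R).

Lemma tuple_consK n (s : n.+1.-tuple R) :
  tuple_cons (thead s : measurableTypeR R, [tuple of behead s]) = s.
Proof. by rewrite [RHS]tuple_eta; exact/val_inj. Qed.

Lemma tnth_cons0 n (p : measurableTypeR R * n.-tuple R) :
  tnth (tuple_cons p) ord0 = p.1.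
Proof. by []. Qed.

Lemma tnth_consS n (p : measurableTypeR R * n.-tuple R) (i : 'I_n) :
  tnth (tuple_cons p) (lift ord0 i) = tnth p.2 i.
Proof. by rewrite !(tnth_nth 0). Qed.

Local Open Scope ereal_scope.

(** Tonelli's theorem: the first coordinate is separated from the others. *)
Lemma ge0_integral_tuple_cons n (h : n.+1.-tuple R -> \bar R) :
  measurable_fun setT h -> (forall s, 0 <= h s) ->
  \int[lebesgue_tuple n.+1]_s h s =
  \int[mu]_x \int[lebesgue_tuple n]_v h (tuple_cons (x, v)).
Proof.
move=> mh h0.
rewrite [LHS](@ge0_integral_pushforward _ _ _ _ R _ (@measurable_tuple_cons R n)
  (mu \x lebesgue_tuple n) setT)// preimage_setT.
rewrite fubini_tonelli1//=.
by apply: measurableT_comp => //; exact: measurable_tuple_cons.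
Qed.

Lemma measurable_tuple_tensor n (f : R -> R) (g : n.-tuple R -> R)
    (h : n.+1.-tuple R -> R) : measurable_fun setT f -> measurable_fun setT g ->
  (forall x v, h (tuple_cons (x, v)) = f x * g v)%R -> measurable_fun setT h.
Proof.
move=> mf mg hE.
rewrite (_ : h = fun s => f (thead s) * g [tuple of behead s])%R; last first.
  by apply/funext => s; rewrite -{1}(tuple_consK s) hE.
apply: measurable_funM; apply: measurableT_comp => //.
- exact: (@measurable_tnth _ R n.+1 ord0).
- exact: measurable_behead.
Qed.

Lemma integrable_tuple_tensor n (f : R -> R) (g : n.-tuple R -> R)
    (h : n.+1.-tuple R -> R) : mu.-integrable setT (EFin \o f) ->
  (lebesgue_tuple n).-integrable setT (EFin \o g) ->
  (forall x v, h (tuple_cons (x, v)) = f x * g v)%R ->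
  (lebesgue_tuple n.+1).-integrable setT (EFin \o h).
Proof.
move=> intf intg hE.
have /measurable_EFinP mf := measurable_int _ intf.
have /measurable_EFinP mg := measurable_int _ intg.
have mh : measurable_fun setT h by exact: measurable_tuple_tensor hE.
apply/integrableP; split; first exact/measurable_EFinP.
rewrite ge0_integral_tuple_cons//; last first.
  by apply/measurable_EFinP; exact: measurableT_comp.
under eq_integral.
  move=> x _; under eq_integral do rewrite /= hE normrM EFinM.
  rewrite ge0_integralZl//; last first.
    by apply/measurable_EFinP; exact: measurableT_comp.
  over.
rewrite ge0_integralZr//; last 2 first.
  by apply/measurable_EFinP; exact: measurableT_comp.
  by apply: integral_ge0.
rewrite lte_mul_pinfty//.
- by apply: integral_ge0.
- rewrite ge0_fin_numE; last by apply: integral_ge0.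
  by have /integrableP[] := intf.
- by have /integrableP[] := intg.
Qed.

(** Fubini's theorem for a product of a function of the first coordinate and a
    function of the others. *)
Lemma Rintegral_tuple_tensor n (f : R -> R) (g : n.-tuple R -> R)
    (h : n.+1.-tuple R -> R) : mu.-integrable setT (EFin \o f) ->
  (lebesgue_tuple n).-integrable setT (EFin \o g) ->
  (forall x v, h (tuple_cons (x, v)) = f x * g v)%R ->
  (\int[lebesgue_tuple n.+1]_s h s =
   (\int[mu]_x f x) * \int[lebesgue_tuple n]_v g v)%R.
Proof.
move=> intf intg hE.
have inth := integrable_tuple_tensor intf intg hE.
have mc := @measurable_tuple_cons R n.
have mh : measurable_fun setT (EFin \o h) by exact: measurable_int inth.
have mhc : measurable_fun setT (EFin \o h \o @tuple_cons R n).
  exact: measurableT_comp.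
have inthc : (mu \x lebesgue_tuple n).-integrable setT (EFin \o h \o @tuple_cons R n).
  apply/integrableP; split => //; have /integrableP[_] := inth.
  rewrite [X in X < _](@ge0_integral_pushforward _ _ _ _ R _ mc
    (mu \x lebesgue_tuple n) setT)//.
  exact: measurableT_comp.
rewrite /Rintegral.
rewrite [X in fine X = _](@integral_pushforward _ _ _ _ R _ mc
  (mu \x lebesgue_tuple n) setT)//.
rewrite preimage_setT -integral12_prod_meas1//.
rewrite -fineM; [|exact: integrable_fin_num..]; congr fine.
rewrite -(fineK (integrable_fin_num measurableT intg)) -integralZr//.
apply: eq_integral => x _; rewrite fineK; last exact: integrable_fin_num.
rewrite -integralZl//.
by apply: eq_integral => v _; rewrite /= hE EFinM.
Qed.

Lemma integral_tuple0 (h : 0.-tuple R -> R) :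
  (\int[lebesgue_tuple 0]_s h s = h [tuple])%R.
Proof.
rewrite /Rintegral [X in fine X](@integral_dirac _ _ ([tuple] : 0.-tuple R))//.
  by rewrite diracT mul1e.
rewrite (_ : (fun _ => _) = cst (h [tuple])%:E); first exact: measurable_cst.
by apply/funext => s; rewrite (tuple0 s).
Qed.

Lemma integrable_tuple0 (h : 0.-tuple R -> R) :
  (lebesgue_tuple 0).-integrable setT (EFin \o h).
Proof.
rewrite (_ : EFin \o h = cst (h [tuple])%:E); last first.
  by apply/funext => s; rewrite /= (tuple0 s).
apply/integrableP; split; first exact: measurable_cst.
rewrite [X in X < _](@integral_dirac _ _ ([tuple] : 0.-tuple R))//.
by rewrite diracT mul1e ltry.
Qed.

End lebesgue_tuple.

(** * Variables with a density *)

Section density.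
Context d (T : measurableType d) (R : realType) (P : probability T R).
Context n (X : {RV P >-> n.-tuple R}) (f : n.-tuple R -> R).
Hypotheses (f0 : forall s, 0 <= f s) (mf : measurable_fun setT f).
Hypothesis Xf : has_density X f.

Lemma density_mass : (\int[lebesgue_tuple n]_s (f s)%:E = 1)%E.
Proof. by rewrite -Xf// probability_setT. Qed.

Lemma integrable_density : (lebesgue_tuple n).-integrable setT (EFin \o f).
Proof.
apply/integrableP; split; first exact/measurable_EFinP.
under eq_integral do rewrite gee0_abs ?lee_fin//.
by rewrite density_mass ltry.
Qed.

Lemma integrable_bmeas_density (h : n.-tuple R -> R) : bmeas h ->
  (lebesgue_tuple n).-integrable setT (fun s => (h s * f s)%:E).
Proof.
move=> [mh [M hM]]; apply: (@le_integrable _ _ _ _ _ _ _ (fun s => (M * f s)%:E)) => //.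
- by apply/measurable_EFinP; exact: measurable_funM.
- move=> s _; rewrite lee_fin !normrM ler_wpM2r// (le_trans (hM s))//.
  exact: ler_norm.
- by under eq_fun do rewrite EFinM; apply: integrableZl => //; exact: integrable_density.
Qed.

(** The expectation of a function of [X] is its integral against the density. *)
Lemma expectation_density (h : n.-tuple R -> R) : bmeas h ->
  \int[P]_w h (X w) = \int[lebesgue_tuple n]_s (h s * f s).
Proof.
move=> bh; rewrite /Rintegral; congr fine.
have mX : measurable_fun setT X by exact: measurable_funP.
rewrite -(integral_transfer mX (@measurable_id _ _ setT) (W1 := fun=> 1) (mu1 := P)
  (fun=> ler01) f0 (@measurable_cst _ _ _ _ _ _) mf _ bh.1).
- by apply: eq_integral => w _; rewrite mulr1.
- move=> A mA; rewrite preimage_id -Xf// integral_cst ?mul1e//.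
  by rewrite -[_ @^-1` _]setTI; exact: mX.
- apply: bmeas_integrable; apply: bmeasM; last exact: bmeas_cst.
  by case: bh => mh [M hM]; split; [exact: measurableT_comp|exists M].
- exact: integrable_bmeas_density.
Qed.

(** The values of [X] lie almost surely in the support of its density. *)
Lemma density_support (A : set (n.-tuple R)) : measurable A ->
  (forall s, ~ A s -> f s = 0) -> P (X @^-1` ~` A) = 0%E.
Proof.
move=> mA fA; rewrite [LHS]Xf; last exact: measurableC.
by apply: integral0_eq => s /= nAs; rewrite fA.
Qed.

End density.

(** * The Gamma function at half-integers *)

Section fundamental_theorem.
Context {R : realType}.
Local Notation mu := (@lebesgue_measure R).

Lemma FTC_is_derive (f F : R -> R) (a b : R) : a < b ->
  (forall x : R, is_derive x 1 F (f x)) -> continuous f ->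
  \int[mu]_(x in `[a, b]) f x = F b - F a.
Proof.
move=> ab dF cf; rewrite /Rintegral (@continuous_FTC2 _ f F)//.
- exact: continuous_subspaceT.
- have cF : continuous F.
    move=> x; apply/differentiable_continuous/derivable1_diffP.
    exact: ex_derive.
  split => [x _||]; first exact: ex_derive.
    exact/cvg_at_right_filter/cF.
  exact/cvg_at_left_filter/cF.
- by move=> x _; rewrite derive1E; apply: derive_val.
Qed.

Lemma is_derive_pow (f : R -> R) n (x df : R) : is_derive x (1 : R) f df ->
  is_derive x (1 : R) (fun u => f u ^+ n) (n%:R * f x ^+ n.-1 * df).
Proof.
move=> h; rewrite (_ : (fun u => _) = f ^+ n); first exact: is_deriveX.
by apply/funext => u; rewrite exprfctE.
Qed.

Lemma is_derive_mul (f g : R -> R) (x df dg : R) :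
  is_derive x (1 : R) f df -> is_derive x (1 : R) g dg ->
  is_derive x (1 : R) (fun u => f u * g u) (f x * dg + g x * df).
Proof. by move=> h k; exact: is_deriveM. Qed.

Lemma continuous_integrable_itv (f : R -> R) (a b : R) : continuous f ->
  mu.-integrable `[a, b] (EFin \o f).
Proof.
move=> cf; apply: continuous_compact_integrable; first exact: segment_compact.
exact: continuous_subspaceT.
Qed.

Lemma continuousX (f : R -> R) n : continuous f -> continuous (fun x => f x ^+ n).
Proof.
move=> cf x; apply: (@continuous_comp _ _ _ f (fun y => y ^+ n)); first exact: cf.
exact: exprn_continuous.
Qed.

End fundamental_theorem.

(** The limit of a sequence does not depend on its first term. *)
Lemma cvg_from1 (R : realType) (u v : nat -> R) (l : R) : (forall n, u n.+1 = v n) ->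
  v n @[n --> \oo] --> l -> u n @[n --> \oo] --> l.
Proof.
by move=> uv vl; rewrite -(cvg_shiftS u) (_ : [sequence _]_n = v)//; exact/funext.
Qed.

Section Gamma_half.
Context {R : realType}.
Local Notation mu := (@lebesgue_measure R).

(** [half_gamma m] is the value of the Gamma function at [(m + 1) / 2]. *)
Fixpoint half_gamma (m : nat) : R :=
  match m with
  | 0 => Num.sqrt pi
  | 1 => 1
  | m'.+2 => m'.+1%:R / 2 * half_gamma m'
  end.

Lemma half_gammaSS m : half_gamma m.+2 = m.+1%:R / 2 * half_gamma m.
Proof. by []. Qed.

Lemma half_gamma_gt0 m : 0 < half_gamma m.
Proof.
suff : 0 < half_gamma m /\ 0 < half_gamma m.+1 by case.
elim: m => [|m [IH1 IH2]]; first by rewrite /= sqrtr_gt0 pi_gt0.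
by split => //; rewrite half_gammaSS mulr_gt0// divr_gt0.
Qed.

(** The Gamma integrand at [(m + 1) / 2] after the substitution [s = u ^ 2]; it has
    no singularity at the origin. *)
Let kernel m (u : R) := 2 * (u ^+ m * expR (- u ^+ 2)).

Let continuous_kernel m : continuous (kernel m).
Proof.
move=> x; apply: cvgM; first exact: cvg_cst.
apply: cvgM; first exact: exprn_continuous.
apply: (@continuous_comp _ _ _ (fun u : R => - u ^+ 2) expR).
  by apply: cvgN; exact: exprn_continuous.
exact: continuous_expR.
Qed.

Let is_derive_exp_sqr (x : R) :
  is_derive x 1 (fun u => expR (- u ^+ 2)) (expR (- x ^+ 2) * (- (2 * x))).
Proof.
have dsq : is_derive x (1 : R) (fun u : R => - u ^+ 2) (- (2 * x)).
  apply: (@is_derive_eq _ _ _ _ _ _ _ _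
    (is_deriveN (is_derive_pow 2 (is_derive_id x (1 : R))))).
  by rewrite /= expr1 mulr1.
exact: (@is_derive1_comp R expR (fun u => - u ^+ 2) x _ _ (is_derive_expR _) dsq).
Qed.

(* Integrated over [[0, n]], this is the functional equation of the Gamma function
   with a boundary term that vanishes in the limit. *)
Let is_derive_kernel m (x : R) :
  is_derive x 1 (fun u => - (u ^+ m.+1 * expR (- u ^+ 2)))
    (kernel m.+2 x - m.+1%:R / 2 * kernel m x).
Proof.
have dexp := is_derive_exp_sqr x.
have h := is_deriveN (is_derive_mul (is_derive_pow m.+1 (is_derive_id x (1 : R))) dexp).
apply: (@is_derive_eq _ _ _ _ _ _ _ _ h); rewrite /kernel/= !exprS mulr1.
by field.
Qed.

Let kernel_bound m n :
  0 <= (n.+1%:R : R) ^+ m.+1 * expR (- n.+1%:R ^+ 2) <= m.+1`!%:R * n.+1%:R^-1.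
Proof.
set x : R := n.+1%:R; have x0 : 0 < x by [].
have x1 : 1 <= x by rewrite ler1n.
rewrite mulr_ge0 ?expR_ge0 ?exprn_ge0 ?(ltW x0)//= expRN ler_pdivrMr ?expR_gt0//.
have e := @expR_ge1Dxn R (x ^+ 2) m (exprn_ge0 _ (ltW x0)).
have f0 : 0 < m.+1`!%:R :> R by rewrite ltr0n fact_gt0.
rewrite mulrAC ler_pdivlMr// -ler_pdivrMl//.
apply: (@le_trans _ _ ((x ^+ 2) ^+ m.+1 / m.+1`!%:R)); last first.
  by apply: le_trans e; rewrite lerDr.
rewrite mulrC ler_pM2r ?invr_gt0// -exprSr -exprM ler_weXn2l//.
by rewrite mul2n -addnn addSn ltnS leq_addl.
Qed.

Let gauss_tail m : (n%:R : R) ^+ m.+1 * expR (- n%:R ^+ 2) @[n --> \oo] --> 0.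
Proof.
apply: (cvg_from1 (fun=> erefl)).
apply: (@squeeze_cvgr _ _ _ _ (fun=> 0) (fun n => m.+1`!%:R * n.+1%:R^-1)).
- by apply: nearW => n; exact: kernel_bound.
- exact: cvg_cst.
- rewrite -[X in _ --> X](mulr0 m.+1`!%:R); apply: cvgM; first exact: cvg_cst.
  exact: cvg_harmonic.
Qed.

Let kernel0_cvg : (\int[mu]_(u in `[0, n%:R]) kernel 0 u) @[n --> \oo] --> Num.sqrt pi.
Proof.
have := @ge0_cvgn_integral R mu _ (@gauss_fun_ge0 R)
  (@measurable_gauss_fun R).
rewrite integral0y_gauss => /fine_cvg /= h.
rewrite (_ : Num.sqrt pi = 2 * (Num.sqrt pi / 2)); last by field.
under eq_fun.
  move=> n; rewrite /kernel; under eq_Rintegral do rewrite expr0 mul1r.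
  rewrite RintegralZl//; last first.
    by apply: continuous_integrable_itv; exact: continuous_gauss_fun.
  over.
by apply: cvgM; [exact: cvg_cst|exact: h].
Qed.

Let kernel1_cvg : (\int[mu]_(u in `[0, n%:R]) kernel 1 u) @[n --> \oo] --> (1 : R).
Proof.
have dF (x : R) : is_derive x (1 : R) (fun u => - expR (- u ^+ 2)) (kernel 1 x).
  have dexp := is_derive_exp_sqr x.
  by apply: (@is_derive_eq _ _ _ _ _ _ _ _ (is_deriveN dexp)); rewrite /kernel; ring.
have E n : \int[mu]_(u in `[0, n.+1%:R]) kernel 1 u = 1 - expR (- n.+1%:R ^+ 2).
  rewrite (FTC_is_derive (ltr0Sn _ n) dF (@continuous_kernel 1)).
  by rewrite expr0n/= oppr0 expR0 opprK addrC.
apply: (cvg_from1 E).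
rewrite -[X in _ --> X]subr0; apply: cvgB; first exact: cvg_cst.
apply: (@squeeze_cvgr _ _ _ _ (fun=> 0) (fun n => 1`!%:R * n.+1%:R^-1)).
- apply: nearW => n; rewrite expR_ge0/=.
  have /andP[_] := kernel_bound 0 n; apply: le_trans.
  by rewrite ler_peMl ?expR_ge0// expr1 ler1n.
- exact: cvg_cst.
- rewrite -[X in _ --> X](mulr0 1`!%:R); apply: cvgM; first exact: cvg_cst.
  exact: cvg_harmonic.
Qed.

Let kernelSS_cvg m l : (\int[mu]_(u in `[0, n%:R]) kernel m u) @[n --> \oo] --> (l : R) ->
  (\int[mu]_(u in `[0, n%:R]) kernel m.+2 u) @[n --> \oo] --> m.+1%:R / 2 * l.
Proof.
move=> h.
have E n : \int[mu]_(u in `[0, n.+1%:R]) kernel m.+2 u =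
    m.+1%:R / 2 * (\int[mu]_(u in `[0, n.+1%:R]) kernel m u) -
    n.+1%:R ^+ m.+1 * expR (- n.+1%:R ^+ 2).
  have ik k := continuous_integrable_itv 0 (n.+1%:R) (@continuous_kernel k).
  have ckS : continuous (fun u => m.+1%:R / 2 * kernel m u).
    by move=> x; apply: cvgM; [exact: cvg_cst|exact: continuous_kernel].
  have cB : continuous (fun u => kernel m.+2 u - m.+1%:R / 2 * kernel m u).
    by move=> x; apply: cvgB; [exact: continuous_kernel|exact: ckS].
  have := FTC_is_derive (ltr0Sn _ n) (is_derive_kernel m) cB.
  rewrite RintegralB//; last exact: continuous_integrable_itv.
  have -> : \int[mu]_(u in `[0, n.+1%:R]) (m.+1%:R / 2 * kernel m u) =
      m.+1%:R / 2 * \int[mu]_(u in `[0, n.+1%:R]) kernel m u.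
    by apply: RintegralZl => //; exact: ik.
  by rewrite expr0n/= mul0r oppr0 subr0 => /eqP; rewrite subr_eq addrC => /eqP ->.
apply: (cvg_from1 E); rewrite -[X in _ --> X]subr0; apply: cvgB.
  apply: cvgM; first exact: cvg_cst.
  by rewrite (cvg_shiftS (fun n => \int[mu]_(u in `[0, n%:R]) kernel m u)).
by rewrite (cvg_shiftS (fun n => n%:R ^+ m.+1 * expR (- n%:R ^+ 2))); exact: gauss_tail.
Qed.

Let kernel_cvg m : (\int[mu]_(u in `[0, n%:R]) kernel m u) @[n --> \oo] --> half_gamma m.
Proof.
suff : (\int[mu]_(u in `[0, n%:R]) kernel m u) @[n --> \oo] --> half_gamma m /\
  (\int[mu]_(u in `[0, n%:R]) kernel m.+1 u) @[n --> \oo] --> half_gamma m.+1 by case.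
elim: m => [|m [IH1 IH2]]; first by split; [exact: kernel0_cvg|exact: kernel1_cvg].
by split => //; exact: kernelSS_cvg.
Qed.

Let continuous_sqrt_kernel m : continuous (fun s : R => Num.sqrt s ^+ m * expR (- s)).
Proof.
move=> x; apply: cvgM.
  by apply: (@continuousX _ Num.sqrt) => y; exact: sqrt_continuous.
apply: (@continuous_comp _ _ _ (fun u : R => - u) expR); first exact: cvgN.
exact: continuous_expR.
Qed.

Let substitution_sqr m n : \int[mu]_(u in `[0, n.+1%:R]) kernel m.+1 u =
  \int[mu]_(s in `[0, (n.+1 ^ 2)%:R]) (Num.sqrt s ^+ m * expR (- s)).
Proof.
pose F (u : R) := u ^+ 2; have F0 : F 0 = 0 by rewrite /F expr0n.
have Fn : F n.+1%:R = (n.+1 ^ 2)%:R by rewrite /F natrX.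
have dF (x : R) : is_derive x (1 : R) F (2 * x).
  apply: (@is_derive_eq _ _ _ _ _ _ _ _ (is_derive_pow 2 (is_derive_id x (1 : R)))).
  by rewrite /= expr1 mulr1.
have F'E : F^`()%classic = fun x => 2 * x.
  by apply/funext => x; rewrite derive1E; apply: derive_val.
have cF' : continuous (F^`()%classic).
  by rewrite F'E => x; apply: cvgM; [exact: cvg_cst|exact: cvg_id].
have cF : continuous F by move=> x; exact: exprn_continuous.
rewrite -Fn -[in RHS]F0 /Rintegral integration_by_substitution_increasing//.
- congr fine; apply: eq_integral => u /[!inE]/= /[!in_itv]/= /andP[u0 _].
  congr EFin; rewrite F'E /kernel !fctE /F sqrtr_sqr ger0_norm// exprSr.
  by ring.
- move=> x y /[!in_itv]/= /andP[x0 _] /andP[y0 _] xy.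
  by rewrite /F ltr_pXn2r// nnegrE.
- by apply/cvg_ex; exists (F^`()%classic 0); apply: cvg_at_right_filter; apply: cF'.
- by apply/cvg_ex; exists (F^`()%classic n.+1%:R); apply: cvg_at_left_filter; apply: cF'.
- split; first by move=> x _; exact: ex_derive.
    exact/cvg_at_right_filter/cF.
  exact/cvg_at_left_filter/cF.
- by apply: continuous_subspaceT; exact: continuous_sqrt_kernel.
Qed.

(** The Gamma integral at [(m + 2) / 2] is the limit of its restrictions to the
    intervals [[0, (n + 1) ^ 2]], where [s = u ^ 2] turns it into a Gaussian moment.
    As the argument is at least 1, the integrand [s ^ (m / 2) exp (- s)] is
    continuous at 0. *)
Lemma Gamma_half m : Gamma (m.+2%:R / 2 : R) = half_gamma m.+1.
Proof.
pose G (s : R) := Num.sqrt s ^+ m * expR (- s).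
have G0 s : 0 <= G s by rewrite mulr_ge0 ?exprn_ge0 ?sqrtr_ge0 ?expR_ge0.
have mG : measurable_fun setT G.
  by apply: continuous_measurable_fun; exact: continuous_sqrt_kernel.
have sq_cvg : (fun n : nat => (n.+1 ^ 2)%N) @ \oo --> \oo.
  apply/cvgnyPge => N; near=> n.
  have Nn : (N <= n)%N by near: n; exists N.
  by rewrite (leq_trans Nn)// (leq_trans (leqnSn n))// leq_pmulr.
have lim1 : (\int[mu]_(s in `[0%R, ((n.+1 ^ 2)%:R)%R]) (G s)%:E)%E @[n --> \oo] -->
    (\int[mu]_(s in `[0%R, +oo[) (G s)%:E)%E.
  exact: (cvg_comp _ _ sq_cvg (@ge0_cvgn_integral R mu G G0 mG)).
have lim2 : (\int[mu]_(s in `[0%R, ((n.+1 ^ 2)%:R)%R]) (G s)%:E)%E @[n --> \oo] -->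
    (half_gamma m.+1)%:E.
  have h : \int[mu]_(u in `[0, n.+1%:R]) kernel m.+1 u @[n --> \oo] --> half_gamma m.+1.
    rewrite (cvg_shiftS (fun n => \int[mu]_(u in `[0, n%:R]) kernel m.+1 u)).
    exact: kernel_cvg.
  rewrite (_ : (fun n => _) = fun n => (\int[mu]_(u in `[0, n.+1%:R]) kernel m.+1 u)%:E).
    by apply: cvg_EFin => //; exact: nearW.
  apply/funext => n; rewrite substitution_sqr fineK//.
  apply: integrable_fin_num => //; apply: continuous_integrable_itv.
  exact: continuous_sqrt_kernel.
have GE : (\int[mu]_(s in `[0%R, +oo[) (G s)%:E = (half_gamma m.+1)%:E)%E.
  exact: cvg_unique lim1 lim2.
rewrite /Gamma /Rintegral.
rewrite (_ : integral _ _ _ = (\int[mu]_(s in `]0%R, +oo[) (G s)%:E)%E).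
  by rewrite integral_itv_obnd_cbnd ?GE//; exact/measurable_EFinP/measurable_funTS.
apply: eq_integral => s /[!inE]/= /[!in_itv]/= /andP[s0 _]; congr (_ * _)%:E.
rewrite -(powR12_sqrt (ltW s0)) -powR_mulrn ?powR_ge0// -powRrM; congr (_ `^ _).
by rewrite -addn2 natrD; field.
Unshelve. all: by end_near. Qed.

End Gamma_half.

Section half_gamma_identities.
Context {R : realType}.
Local Notation hg := (@half_gamma R).

Lemma half_gamma_neq0 m : hg m != 0.
Proof. by rewrite gt_eqF// half_gamma_gt0. Qed.

(** Legendre's duplication formula at half-integers. *)
Lemma half_gamma_duplication m : hg m * hg m.+1 = Num.sqrt pi * m`!%:R / 2 ^+ m.
Proof.
elim: m => [|m IH]; first by rewrite /= fact0 expr0 divr1.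
rewrite half_gammaSS mulrCA (mulrC (hg m.+1)) IH factS natrM exprS; field.
by rewrite expf_neq0.
Qed.

Lemma half_gamma_even k : hg k.*2 = Num.sqrt pi * k.*2`!%:R / (4 ^+ k * k`!%:R).
Proof.
elim: k => [|k IH]; first by rewrite /= !fact0 expr0 !mulr1 divr1.
rewrite doubleS half_gammaSS IH 3!factS !natrM exprS.
have k0 : k`!%:R != 0 :> R by rewrite pnatr_eq0 -lt0n fact_gt0.
have k2 : k.*2.+2%:R = 2 * k.+1%:R :> R by rewrite -doubleS -mul2n natrM.
rewrite k2; field.
by rewrite k0 nat1r pnatr_eq0 expf_neq0.
Qed.

Lemma half_gamma_odd k : hg k.*2.+1 = k`!%:R.
Proof.
elim: k => [|k IH]; first by rewrite fact0.
rewrite doubleS half_gammaSS IH factS natrM -doubleS -mul2n natrM.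
by rewrite (mulrC 2) mulfK.
Qed.

Lemma Gamma_nat m : Gamma (m.+1%:R : R) = m`!%:R.
Proof.
by rewrite -half_gamma_odd -Gamma_half -doubleS -mul2n natrM mulrC mulKf.
Qed.

End half_gamma_identities.

(** * Integrals of products of powers of sine and cosine *)

Section trig_integrals.
Context {R : realType}.
Local Notation mu := (@lebesgue_measure R).
Local Notation hg := (@half_gamma R).

(** Integrals of [sin ^ a * cos ^ b] over [[0, L]]; the two lengths that occur are
    [pi] and [2 * pi]. *)
Definition trig (L : R) (a b : nat) : R :=
  \int[mu]_(x in `[0, L]) (sin x ^+ a * cos x ^+ b).

Lemma continuous_trig a b : continuous (fun x : R => sin x ^+ a * cos x ^+ b).
Proof.
move=> x; apply: cvgM.
  by apply: (@continuousX _ sin) => y; exact: continuous_sin.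
by apply: (@continuousX _ cos) => y; exact: continuous_cos.
Qed.

Variable L : R.
Hypotheses (L0 : 0 < L) (sinL : sin L = 0).

Lemma trig_split a b : trig L a b = trig L a.+2 b + trig L a b.+2.
Proof.
rewrite /trig -RintegralD//; try by apply: continuous_integrable_itv; exact: continuous_trig.
apply: eq_Rintegral => x _; rewrite -[LHS]mul1r -(cos2Dsin2 x) !exprS.
by ring.
Qed.

(** Integration by parts. *)
Lemma trig_rec a b : a.+1%:R * trig L a b.+2 = b.+1%:R * trig L a.+2 b.
Proof.
have dF (x : R) : is_derive x (1 : R) (fun u => sin u ^+ a.+1 * cos u ^+ b.+1)
    (a.+1%:R * (sin x ^+ a * cos x ^+ b.+2) - b.+1%:R * (sin x ^+ a.+2 * cos x ^+ b)).
  apply: (@is_derive_eq _ _ _ _ _ _ _ _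
    (is_derive_mul (is_derive_pow a.+1 (is_derive_sin x)) (is_derive_pow b.+1 (is_derive_cos x)))).
  by rewrite /= !exprS; ring.
have cM c i j : continuous (fun x : R => c * (sin x ^+ i * cos x ^+ j)).
  by move=> x; apply: cvgM; [exact: cvg_cst|exact: continuous_trig].
have cF : continuous (fun x : R => a.+1%:R * (sin x ^+ a * cos x ^+ b.+2) -
    b.+1%:R * (sin x ^+ a.+2 * cos x ^+ b)).
  by move=> x; apply: cvgB; exact: cM.
have := FTC_is_derive L0 dF cF.
have ZE c i j : \int[mu]_(x in `[0, L]) (c * (sin x ^+ i * cos x ^+ j)) = c * trig L i j.
  by apply: RintegralZl => //; apply: continuous_integrable_itv; exact: continuous_trig.
rewrite RintegralB//; try by apply: continuous_integrable_itv; exact: cM.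
by rewrite !ZE sinL sin0 !expr0n/= !mul0r subrr => /eqP; rewrite subr_eq0 => /eqP.
Qed.

Lemma trig_cos1 a : trig L a 1 = 0.
Proof.
have dF (x : R) : is_derive x (1 : R) (fun u => sin u ^+ a.+1)
    (a.+1%:R * (sin x ^+ a * cos x ^+ 1)).
  apply: (@is_derive_eq _ _ _ _ _ _ _ _ (is_derive_pow a.+1 (is_derive_sin x))).
  by rewrite /= expr1 mulrA.
have cF : continuous (fun x : R => a.+1%:R * (sin x ^+ a * cos x ^+ 1)).
  by move=> x; apply: cvgM; [exact: cvg_cst|exact: continuous_trig].
have := FTC_is_derive L0 dF cF.
rewrite RintegralZl//; last by apply: continuous_integrable_itv; exact: continuous_trig.
rewrite sinL sin0 !expr0n/= subrr => /eqP.
by rewrite mulf_eq0 pnatr_eq0 => /eqP.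
Qed.

Lemma trig_odd_cos a b : trig L a b.*2.+1 = 0.
Proof.
elim: b a => [|b IH] a; first exact: trig_cos1.
have := trig_rec a b.*2.+1; rewrite doubleS IH mulr0 => /eqP.
by rewrite mulf_eq0 pnatr_eq0 => /eqP.
Qed.

Lemma trig_sin_rec a : a.+2%:R * trig L a.+2 0 = a.+1%:R * trig L a 0.
Proof.
have := trig_rec a 0; rewrite mul1r (trig_split a 0) => h.
by rewrite mulrDr h -!natr1; ring.
Qed.

(** The value of the integral without cosines is known, up to a factor [c], as soon
    as it is known for the exponent of the same parity that is 0 or 1. *)
Lemma trig_cos0 (c : R) a :
  trig L (odd a) 0 = c * (hg (odd a) * hg 0 / hg (odd a).+1) ->
  trig L a 0 = c * (hg a * hg 0 / hg a.+1).
Proof.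
elim/ltn_ind: a => -[|[|a]] IH h; [exact: h|exact: h|].
have IHa : trig L a 0 = c * (hg a * hg 0 / hg a.+1).
  by apply: IH => //; move: h; rewrite oddS oddS negbK.
have a2 : a.+2%:R != 0 :> R by rewrite pnatr_eq0.
apply: (mulfI a2); rewrite trig_sin_rec IHa.
rewrite !half_gammaSS; field.
by rewrite half_gamma_neq0 -natrD pnatr_eq0.
Qed.

(** The Beta integral in trigonometric form; the factor [c] depends on [L] and on
    the parity of [a] only. *)
Lemma trig_even_cos (c : R) a b :
  trig L (odd a) 0 = c * (hg (odd a) * hg 0 / hg (odd a).+1) ->
  trig L a b.*2 = c * (hg a * hg b.*2 / hg (a + b.*2).+1).
Proof.
elim: b a => [|b IH] a h; first by rewrite addn0; exact: trig_cos0.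
have a1 : a.+1%:R != 0 :> R by rewrite pnatr_eq0.
apply: (mulfI a1); rewrite doubleS trig_rec IH; last by rewrite /= negbK.
rewrite !addSn !addnS !half_gammaSS; field.
by rewrite half_gamma_neq0 -!natrD pnatr_eq0.
Qed.

End trig_integrals.

Section trig_pi.
Context {R : realType}.
Local Notation hg := (@half_gamma R).

Lemma trig_cst (L : R) : 0 < L -> trig L 0 0 = L.
Proof.
move=> L0; rewrite /trig; under eq_Rintegral do rewrite !expr0 mulr1.
by rewrite Rintegral_cst//= mul1r lebesgue_measure_itv/= lte_fin L0 oppr0 adde0.
Qed.

Lemma trig_sin1 (L : R) : 0 < L -> trig L 1 0 = 1 - cos L.
Proof.
move=> L0.
have dF (x : R) : is_derive x (1 : R) (fun u => - cos u) (sin x ^+ 1 * cos x ^+ 0).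
  apply: (@is_derive_eq _ _ _ _ _ _ _ _ (is_deriveN (is_derive_cos x))).
  by rewrite opprK expr1 expr0 mulr1.
by rewrite /trig (FTC_is_derive L0 dF (@continuous_trig _ 1 0)) cos0 opprK addrC.
Qed.

Lemma trig_pi_even a b : trig pi a b.*2 = hg a * hg b.*2 / hg (a + b.*2).+1.
Proof.
rewrite -[RHS]mul1r; apply: trig_even_cos; [exact: pi_gt0|exact: sinpi|].
have p2 : Num.sqrt pi * Num.sqrt pi = pi :> R by rewrite -expr2 sqr_sqrtr// pi_ge0.
case: odd; rewrite mul1r/=.
  rewrite trig_sin1 ?pi_gt0// cospi; field.
  by rewrite gt_eqF// sqrtr_gt0 pi_gt0.
by rewrite trig_cst ?pi_gt0// p2 divr1.
Qed.

Lemma sin_2pi : sin (2 * pi) = 0 :> R.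
Proof. by rewrite mulr_natl sin2pi. Qed.

Lemma trig_2pi_odd a b : odd a -> trig (2 * pi : R) a b.*2 = 0.
Proof.
move=> oa; rewrite (@trig_even_cos _ _ _ _ 0) ?mul0r//.
- by rewrite mulr_gt0// pi_gt0.
- exact: sin_2pi.
- rewrite oa trig_sin1 ?mulr_gt0 ?pi_gt0// mulr_natl.
  by rewrite cos2pi subrr.
Qed.

Lemma trig_2pi_even a b : ~~ odd a ->
  trig (2 * pi) a b.*2 = 2 * (hg a * hg b.*2 / hg (a + b.*2).+1).
Proof.
move=> oa; apply: trig_even_cos.
- by rewrite mulr_gt0// pi_gt0.
- exact: sin_2pi.
- rewrite (negbTE oa) trig_cst ?mulr_gt0 ?pi_gt0//=.
  by rewrite -expr2 sqr_sqrtr ?pi_ge0// divr1.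
Qed.

End trig_pi.

(** * Moments of the projections of the directions *)

Section angle_moments.
Context {R : realType}.
Local Notation mu := (@lebesgue_measure R).
Local Notation hg := (@half_gamma R).

(** The density of the angles without its normalising constant. *)
Definition angle_weight d (th : (d.-1).-tuple R) : R :=
  if [forall i, 0 <= tnth th i <= angle_bound i] then
    \prod_(i < d.-1) sin (tnth th i) ^+ (d - i)
  else 0.

(** The length of the range of the first angle in dimension [d + 2]: the first angle
    is also the last one in dimension 2. *)
Definition first_bound (d : nat) : R := if d == 0%N then 2 * pi else pi.

(** The coordinates of a vector except the first. *)
Definition tail d (alpha : 'rV[R]_d.+1) : 'rV[R]_d :=
  \row_i alpha 0 (lift ord0 i).

Lemma forall_ord_recl n (p : pred 'I_n.+1) :
  [forall i, p i] = p ord0 && [forall i, p (lift ord0 i)].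
Proof.
apply/forallP/andP => [h|[h0 /forallP h] i].
  by split; [exact: h|apply/forallP => i; exact: h].
by case: (unliftP ord0 i) => [j ->|->].
Qed.

Lemma angle_weight_cons d (x : R) (v : d.-tuple R) :
  @angle_weight d.+2 (tuple_cons (x, v)) =
  (sin x ^+ d.+2 * \1_(`[0, first_bound d]%classic) x) * @angle_weight d.+1 v.
Proof.
rewrite /angle_weight forall_ord_recl big_ord_recl tnth_cons0/=.
have bE : @angle_bound R d.+2 ord0 = first_bound d.
  by rewrite /angle_bound /first_bound /= subn2 eq_sym.
have aE : [forall i, 0 <= tnth (tuple_cons (x, v)) (lift ord0 i) <=
      @angle_bound R d.+2 (lift ord0 i)] =
    [forall i, 0 <= tnth v i <= @angle_bound R d.+1 i].
  apply: eq_forallb => i; rewrite tnth_consS /angle_bound /=.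
  rewrite /bump/= add1n !subn2 /=; case: d v i {bE} => [|d] v i; first by case: i.
  by rewrite eqSS.
rewrite bE aE indicE mem_setE in_itv/=.
case: ifPn => [/andP[-> ->]|/nandP[/negbTE ->|/negbTE ->]]; last 2 first.
- by rewrite mulr0 mul0r.
- by rewrite mulr0.
rewrite mulr1 subn0; congr (_ * _); apply: eq_bigr => i _.
by rewrite tnth_consS /= /bump/= add1n subSS.
Qed.

Lemma dot_direction_cons d (alpha : 'rV[R]_d.+2) (x : R) (v : d.-tuple R) :
  dot alpha (@direction R d.+2 (tuple_cons (x, v))) =
  alpha 0 0 * cos x + sin x * dot (tail alpha) (@direction R d.+1 v).
Proof.
rewrite /dot big_ord_recl !mxE/= big_pred0 ?mul1r//; congr (_ + _).
rewrite mulr_sumr; apply: eq_bigr => i _; rewrite !mxE /= /bump/= !add1n.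
rewrite big_mkcond big_ord_recl/= tnth_cons0 /= ltnS [in RHS]big_mkcond/=.
rewrite (eq_bigr (fun m : 'I_d => if (m < i)%N then sin (tnth v m) else 1)); last first.
  by move=> m _; rewrite tnth_consS /bump/= add1n ltnS.
by rewrite add0n; ring.
Qed.

(** The unnormalised moment of order [K] of the projection of a direction on
    [alpha]. *)
Definition angle_moment d (alpha : 'rV[R]_d) (K : nat) : R :=
  \int[lebesgue_tuple d.-1]_th (dot alpha (direction th) ^+ K * angle_weight th).

(** The factor depending on the first angle [x] in a term of the binomial expansion of
    the integrand of [angle_moment]. *)
Let cons_factor d m j (x : R) : R :=
  sin x ^+ m * cos x ^+ j * \1_(`[0, first_bound d]%classic) x.

Let cons_factorE d (alpha : 'rV[R]_d.+2) K x (v : d.-tuple R) :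
  dot alpha (@direction R d.+2 (tuple_cons (x, v))) ^+ K *
    @angle_weight d.+2 (tuple_cons (x, v)) =
  \sum_(m < K.+1) ('C(K, m)%:R * alpha 0 0 ^+ (K - m)) *
    (cons_factor d (d.+2 + m) (K - m) x *
     (dot (tail alpha) (@direction R d.+1 v) ^+ m * @angle_weight d.+1 v)).
Proof.
rewrite dot_direction_cons angle_weight_cons exprDn mulr_suml.
apply: eq_bigr => m _; rewrite !exprMn -mulr_natl /cons_factor exprD.
by ring.
Qed.

Let integrable_cons_factor d m j : mu.-integrable setT (EFin \o cons_factor d m j).
Proof.
apply: integrable_mul_indic => //; apply: continuous_integrable_itv.
exact: continuous_trig.
Qed.

(** That term, without its constant coefficient: a function of the first angle times
    a function of the others. *)
Let tensor_term d (alpha : 'rV[R]_d.+2) K (m : nat) (th : (d.+1).-tuple R) :=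
  cons_factor d (d.+2 + m) (K - m) (thead th) *
   (dot (tail alpha) (@direction R d.+1 [tuple of behead th]) ^+ m *
    @angle_weight d.+1 [tuple of behead th]).

Let tensor_termE d (alpha : 'rV[R]_d.+2) K m x (v : d.-tuple R) :
  tensor_term alpha K m (tuple_cons (x, v)) = cons_factor d (d.+2 + m) (K - m) x *
   (dot (tail alpha) (@direction R d.+1 v) ^+ m * @angle_weight d.+1 v).
Proof.
rewrite /tensor_term.
have -> : [tuple of behead (tuple_cons (x, v))] = v :> d.-tuple R by exact/val_inj.
by [].
Qed.

Let moment_integrand_cons d (alpha : 'rV[R]_d.+2) K :
  (fun th : (d.+1).-tuple R => dot alpha (@direction R d.+2 th) ^+ K * @angle_weight d.+2 th) =
  fun th => \sum_(m < K.+1) ('C(K, m)%:R * alpha 0 0 ^+ (K - m)) *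
              tensor_term alpha K m th.
Proof.
apply/funext => th; rewrite -(tuple_consK th) cons_factorE.
by apply: eq_bigr => m _; rewrite tensor_termE.
Qed.

Lemma integrable_angle_moment d (alpha : 'rV[R]_d.+1) K :
  (lebesgue_tuple d).-integrable setT
    (EFin \o (fun th => dot alpha (@direction R d.+1 th) ^+ K * @angle_weight d.+1 th)).
Proof.
elim: d => [|d IH] in alpha K *; first exact: integrable_tuple0.
rewrite moment_integrand_cons; apply: integrable_sum_EFin => m.
under [X in _.-integrable _ X]eq_fun do rewrite /= EFinM.
apply: integrableZl => //.
by apply: (integrable_tuple_tensor (integrable_cons_factor _ _ _) (IH _ _)) => x v;
  exact: tensor_termE.
Qed.

(** Integration over the first angle. The remaining angles are those of a direction
    in one dimension less. *)
Lemma angle_moment_rec d (alpha : 'rV[R]_d.+2) K :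
  angle_moment alpha K = \sum_(m < K.+1) ('C(K, m)%:R * alpha 0 0 ^+ (K - m)) *
    (trig (first_bound d) (d.+2 + m) (K - m) * angle_moment (tail alpha) m).
Proof.
rewrite /angle_moment moment_integrand_cons Rintegral_sum => [|m]; last first.
  under [X in _.-integrable _ X]eq_fun do rewrite /= EFinM.
  apply: integrableZl => //.
  by apply: (integrable_tuple_tensor (integrable_cons_factor _ _ _)
    (integrable_angle_moment _ _)) => x v; exact: tensor_termE.
apply: eq_bigr => m _; rewrite RintegralZl//; last first.
  by apply: (integrable_tuple_tensor (integrable_cons_factor _ _ _)
    (integrable_angle_moment _ _)) => x v; exact: tensor_termE.
congr (_ * _); rewrite (Rintegral_tuple_tensor (integrable_cons_factor d (d.+2 + m) (K - m))
  (integrable_angle_moment (tail alpha) m) (tensor_termE alpha K m)).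
by congr (_ * _); rewrite /trig [RHS]Rintegral_mul_indic.
Qed.

(** In dimension 1 there are no angles and the only direction is 1. *)
Lemma angle_moment1 (alpha : 'rV[R]_1) K : angle_moment alpha K = alpha 0 0 ^+ K.
Proof.
rewrite /angle_moment [LHS]integral_tuple0.
rewrite /angle_weight; case: ifPn => [_|/forallPn[[]//]].
rewrite big_ord0 mulr1; congr (_ ^+ _).
by rewrite /dot big_ord1 !mxE big_ord0 ltnn !mulr1.
Qed.

End angle_moments.

Section angle_moments_closed_form.
Context {R : realType}.
Local Notation hg := (@half_gamma R).

(** [divided_pow x k] is [x ^ k / k!]. *)
Definition divided_pow (x : R) (k : nat) : R := x ^+ k / k`!%:R.

(** Up to factors depending only on [k] and on the dimension, the moment of order
    [2 k] of the projection of a direction on a vector of squared norm [r] whose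
    last coordinate has square [a]: the divided power [r ^ k / k!], to which the
    operator [1 + 2 a d/dr] is applied. *)
Definition moment_poly (r a : R) (k : nat) : R :=
  divided_pow r k + 2 * a * (if k is k'.+1 then divided_pow r k' else 0).

Lemma divided_powD (x y : R) k :
  \sum_(j < k.+1) divided_pow x (k - j) * divided_pow y j = divided_pow (x + y) k.
Proof.
rewrite [RHS]/divided_pow exprDn mulr_suml; apply: eq_bigr => j _.
have jk : (j <= k)%N by rewrite -ltnS.
have f0 i : i`!%:R != 0 :> R by rewrite pnatr_eq0 -lt0n fact_gt0.
rewrite /divided_pow -mulr_natl.
have <- : ('C(k, j) * (j`! * (k - j)`!))%:R = k`!%:R :> R by rewrite bin_fact.
rewrite !natrM; field.
by rewrite !f0 pnatr_eq0 -lt0n bin_gt0 jk.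
Qed.

Lemma moment_polyD (x r a : R) k :
  \sum_(j < k.+1) divided_pow x (k - j) * moment_poly r a j = moment_poly (x + r) a k.
Proof.
under eq_bigr do rewrite /moment_poly mulrDr (mulrCA _ (2 * a)).
rewrite big_split/= divided_powD -mulr_sumr /moment_poly; congr (_ + _ * _).
case: k => [|k]; first by rewrite big_ord1/= mulr0.
rewrite big_ord_recl/= mulr0 add0r -divided_powD.
by apply: eq_bigr => j _; rewrite /bump/= add1n subSS.
Qed.

Lemma sum_even (f : nat -> R) k : (forall m, odd m -> f m = 0) ->
  \sum_(m < k.*2.+1) f m = \sum_(j < k.+1) f j.*2.
Proof.
move=> f0; elim: k => [|k IH]; first by rewrite !big_ord1.
rewrite doubleS big_ord_recr big_ord_recr/= IH [RHS]big_ord_recr/= doubleS.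
by rewrite f0 ?addr0//= odd_double.
Qed.

(** The passage from dimension [D - 1] to dimension [D] in abstract form: [V m i] stands
    for the integral of [sin ^ m * cos ^ i] over the range of the first angle, [G] for
    the moments in the lower dimension, [x] for the first coordinate of the vector,
    and [r], [a] for the squared norm of the others and the square of the last. *)
Section moment_step.
Variables (D : nat) (V : nat -> nat -> R) (G : nat -> R) (C c x r a : R).
Hypothesis VG_odd : forall m i, odd m -> V (D + m) i * G m = 0.
Hypothesis V_odd : forall m i, odd i -> V m i = 0.
Hypothesis V_even : forall j i,
  V (D + j.*2) i.*2 = c * (hg (D + j.*2) * hg i.*2 / hg (D + j.*2 + i.*2).+1).
Hypothesis G_even : forall j,
  G j.*2 = C * (j.*2`!%:R / (4 ^+ j * hg (D + j.*2))) * moment_poly r a j.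

Lemma moment_step_odd K : odd K ->
  \sum_(m < K.+1) ('C(K, m)%:R * x ^+ (K - m)) * (V (D + m) (K - m) * G m) = 0.
Proof.
move=> oK; rewrite big1// => m _; case: (boolP (odd m)) => om.
  by rewrite VG_odd// mulr0.
by rewrite V_odd ?mul0r ?mulr0// oddB ?oK ?(negbTE om)// -ltnS.
Qed.

(** The binomial expansion turns into a convolution of divided powers. *)
Lemma moment_step_even k :
  \sum_(m < k.*2.+1) ('C(k.*2, m)%:R * x ^+ (k.*2 - m)) * (V (D + m) (k.*2 - m) * G m) =
  (C * c * Num.sqrt pi) * (k.*2`!%:R / (4 ^+ k * hg (D.+1 + k.*2))) *
    moment_poly (x ^+ 2 + r) a k.
Proof.
rewrite (sum_even (f := fun m => ('C(k.*2, m)%:R * x ^+ (k.*2 - m)) *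
  (V (D + m) (k.*2 - m) * G m))); last by move=> m om; rewrite VG_odd// mulr0.
rewrite -moment_polyD mulr_sumr; apply: eq_bigr => j _.
have jk : (j <= k)%N by rewrite -ltnS.
rewrite -doubleB V_even G_even half_gamma_even /divided_pow.
have <- : ('C(k.*2, j.*2) * (j.*2`! * (k - j).*2`!))%:R = k.*2`!%:R :> R.
  by rewrite doubleB bin_fact// leq_double.
have -> : (D + j.*2 + (k - j).*2 = D + k.*2)%N.
  by rewrite -addnA -doubleD subnKC.
have -> : x ^+ (k - j).*2 = (x ^+ 2) ^+ (k - j) by rewrite -mul2n exprM.
have -> : (4 : R) ^+ k = 4 ^+ (k - j) * 4 ^+ j by rewrite -exprD subnK.
have f0 i : i`!%:R != 0 :> R by rewrite pnatr_eq0 -lt0n fact_gt0.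
rewrite !natrM addSn; field.
by rewrite !f0 !half_gamma_neq0 !expf_neq0.
Qed.

End moment_step.

Lemma dot_recl d (alpha : 'rV[R]_d.+1) :
  dot alpha alpha = alpha 0 0 ^+ 2 + dot (tail alpha) (tail alpha).
Proof.
rewrite /dot big_ord_recl -expr2; congr (_ + _).
by apply: eq_bigr => i _; rewrite !mxE.
Qed.

Lemma tail_last d (alpha : 'rV[R]_d.+2) : tail alpha 0 ord_max = alpha 0 ord_max.
Proof. by rewrite mxE; congr (alpha 0 _); exact/val_inj. Qed.

Lemma trig_2pi_oddl m i : odd m -> trig (2 * pi : R) m i = 0.
Proof.
move=> om; rewrite -(odd_double_half i); case: odd.
  rewrite add1n trig_odd_cos//; first by rewrite mulr_gt0// pi_gt0.
  exact: sin_2pi.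
by rewrite add0n trig_2pi_odd.
Qed.

(** The constant [C] is left unspecified: it is the same for all [alpha] and [k], and
    the total mass of the angle density determines it. The induction starts from
    dimension 1, whose even moments have the same form. The odd moments do not vanish
    there, but they do not contribute in dimension 2: odd powers of the sine integrate
    to 0 over [[0, 2 pi]]. *)
Lemma angle_moment_closed d : exists C : R, forall alpha : 'rV[R]_d.+2,
  (forall K, odd K -> angle_moment alpha K = 0) /\
  (forall k, angle_moment alpha k.*2 =
     C * (k.*2`!%:R / (4 ^+ k * hg (d.+3 + k.*2))) *
     moment_poly (dot alpha alpha) (alpha 0 ord_max ^+ 2) k).
Proof.
have f0 i : i`!%:R != 0 :> R by rewrite pnatr_eq0 -lt0n fact_gt0.
have odd_trig L m i : 0 < L -> sin L = 0 -> odd i -> trig (L : R) m i = 0.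
  move=> L0 sL oi; rewrite -(odd_double_half i) oi add1n; exact: trig_odd_cos.
elim: d => [|d [C IH]].
- exists (Num.sqrt pi / 2 * 2 * Num.sqrt pi) => alpha.
  have V_odd m i : odd i -> trig (2 * pi : R) m i = 0.
    by apply: odd_trig; [rewrite mulr_gt0// pi_gt0|exact: sin_2pi].
  have V_even j i : trig (2 * pi) (2 + j.*2) i.*2 =
      2 * (hg (2 + j.*2) * hg i.*2 / hg (2 + j.*2 + i.*2).+1).
    by apply: trig_2pi_even; rewrite oddD odd_double.
  have VG_odd m i : odd m ->
      trig (2 * pi : R) (2 + m) i * angle_moment (tail alpha) m = 0.
    by move=> om; rewrite trig_2pi_oddl ?mul0r// oddD om.
  have G_even j : angle_moment (tail alpha) j.*2 = Num.sqrt pi / 2 *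
      (j.*2`!%:R / (4 ^+ j * hg (2 + j.*2))) *
      moment_poly (dot (tail alpha) (tail alpha)) (alpha 0 ord_max ^+ 2) j.
    rewrite angle_moment1 -tail_last /dot big_ord1 ord1 -expr2.
    rewrite [ord_max]ord1 add2n half_gammaSS half_gamma_even /moment_poly /divided_pow.
    set y := tail alpha 0 0.
    have p0 : Num.sqrt pi != 0 :> R by rewrite gt_eqF// sqrtr_gt0 pi_gt0.
    have -> : y ^+ j.*2 = (y ^+ 2) ^+ j by rewrite -mul2n exprM.
    have -> : j.*2.+1%:R = 1 + 2 * j%:R :> R by rewrite -natrM mul2n nat1r.
    have j0 : 1 + 2 * j%:R != 0 :> R by rewrite -natrM nat1r pnatr_eq0.
    have : j.*2`!%:R != 0 :> R by exact: f0.
    have : (4 : R) ^+ j != 0 by rewrite expf_neq0.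
    move: (j.*2`!%:R : R) ((4 : R) ^+ j) => F Q Q0 F0.
    case: j j0 => [|j] j0; first by rewrite !expr0 fact0; field; rewrite p0 Q0 F0.
    have fj : 1 + j%:R != 0 :> R by rewrite nat1r pnatr_eq0.
    have {}j0 : 1 + 2 * (1 + j%:R) != 0 :> R by rewrite nat1r.
    rewrite factS !natrM !exprS -!nat1r; field.
    by rewrite f0 fj Q0 F0 p0 j0.
  split=> [K oK|k]; rewrite angle_moment_rec.
    exact: (moment_step_odd _ VG_odd V_odd).
  by rewrite (moment_step_even _ VG_odd V_even G_even) -dot_recl.
- exists (C * 1 * Num.sqrt pi) => alpha; have [IHo IHe] := IH (tail alpha).
  have V_odd m i : odd i -> trig (pi : R) m i = 0.
    by apply: odd_trig; [exact: pi_gt0|exact: sinpi].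
  have V_even j i : trig pi (d.+3 + j.*2) i.*2 =
      1 * (hg (d.+3 + j.*2) * hg i.*2 / hg (d.+3 + j.*2 + i.*2).+1).
    by rewrite trig_pi_even mul1r.
  have VG_odd m i : odd m ->
      trig (pi : R) (d.+3 + m) i * angle_moment (tail alpha) m = 0.
    by move=> om; rewrite IHo// mulr0.
  split=> [K oK|k]; rewrite angle_moment_rec.
    exact: (moment_step_odd _ VG_odd V_odd).
  by rewrite (moment_step_even _ VG_odd V_even IHe) tail_last -dot_recl.
Qed.

End angle_moments_closed_form.

(** * Dirichlet integrals *)

Section dirichlet.
Context {R : realType}.
Local Notation mu := (@lebesgue_measure R).

(** The integrand of the Beta integral over [[0, t]]. *)
Let beta_kernel (t : R) a b (x : R) := x ^+ a * (t - x) ^+ b.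

Let continuous_beta_kernel t a b : continuous (beta_kernel t a b).
Proof.
move=> x; apply: cvgM; first exact: exprn_continuous.
apply: (@continuousX _ (fun x => t - x)) => y; apply: cvgB; first exact: cvg_cst.
exact: cvg_id.
Qed.

Lemma beta_integral (t : R) a b : 0 < t ->
  \int[mu]_(x in `[0, t]) (x ^+ a * (t - x) ^+ b) =
  a`!%:R * b`!%:R / (a + b).+1`!%:R * t ^+ (a + b).+1.
Proof.
move=> t0; have f0 i : i`!%:R != 0 :> R by rewrite pnatr_eq0 -lt0n fact_gt0.
have s0 i : i.+1%:R != 0 :> R by rewrite pnatr_eq0.
have ZE (c : R) i j : \int[mu]_(x in `[0, t]) (c * beta_kernel t i j x) =
    c * \int[mu]_(x in `[0, t]) beta_kernel t i j x.
  by apply: RintegralZl => //; apply: continuous_integrable_itv; exact: continuous_beta_kernel.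
have cM (c : R) i j : continuous (fun x => c * beta_kernel t i j x).
  by move=> x; apply: cvgM; [exact: cvg_cst|exact: continuous_beta_kernel].
elim: b a => [|b IH] a.
  have dF (x : R) : is_derive x (1 : R) (fun u => u ^+ a.+1) (a.+1%:R * beta_kernel t a 0 x).
    apply: (@is_derive_eq _ _ _ _ _ _ _ _ (is_derive_pow a.+1 (is_derive_id x (1 : R)))).
    by rewrite /beta_kernel expr0 !mulr1.
  have := FTC_is_derive t0 dF (cM _ a 0%N).
  rewrite ZE expr0n/= subr0 addn0 fact0 mulr1 => h.
  by apply: (mulfI (s0 a)); rewrite h factS natrM; field; rewrite f0 nat1r s0.
have dsub (x : R) : is_derive x (1 : R) (fun u => t - u) (- 1).
  rewrite (_ : (fun u => t - u) = cst t - id)// -[- 1]sub0r.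
  exact: (is_deriveB (is_derive_cst t x (1 : R)) (is_derive_id x (1 : R))).
have dF (x : R) : is_derive x (1 : R) (fun u => u ^+ a.+1 * (t - u) ^+ b.+1)
    (a.+1%:R * beta_kernel t a b.+1 x - b.+1%:R * beta_kernel t a.+1 b x).
  apply: (@is_derive_eq _ _ _ _ _ _ _ _
    (is_derive_mul (is_derive_pow a.+1 (is_derive_id x (1 : R))) (is_derive_pow b.+1 (dsub x)))).
  by rewrite /beta_kernel/=; ring.
have cF : continuous (fun x => a.+1%:R * beta_kernel t a b.+1 x -
    b.+1%:R * beta_kernel t a.+1 b x).
  by move=> x; apply: cvgB; exact: cM.
have := FTC_is_derive t0 dF cF.
rewrite RintegralB//; try by apply: continuous_integrable_itv; exact: cM.
rewrite !ZE subrr !expr0n/= mul0r mulr0 subrr => /eqP; rewrite subr_eq0 => /eqP h.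
apply: (mulfI (s0 a)); rewrite h [X in _ * X]IH addSnnS !factS !natrM; field.
by rewrite f0 nat1r -natrD nat1r s0.
Qed.

(** The durations, including the last one, [t - (s_1 + .. + s_n)], are positive. *)
Definition admissible n (t : R) (s : n.-tuple R) : bool :=
  [forall j, 0 < tnth s j] && (\sum_(j < n) tnth s j < t).

(** A monomial in the [n + 1] durations, restricted to the simplex where they are
    positive. The densities of the durations are multiples of such functions, which
    are bounded and closed under product. *)
Definition simplex_monomial n (t : R) (e : nat -> nat) (s : n.-tuple R) : R :=
  if admissible t s then \prod_(k < n.+1) tnth (durations t s) k ^+ e k else 0.

End dirichlet.

Section dirichlet_integral.
Context {R : realType}.
Local Notation mu := (@lebesgue_measure R).

Lemma durations_nth n (t : R) (s : n.-tuple R) (k : 'I_n.+1) :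
  tnth (durations t s) k = if (k < n)%N then s`_k else t - \sum_(j < n) tnth s j.
Proof.
rewrite (tnth_nth 0) /= nth_rcons size_tuple; case: ltnP => // nk.
by rewrite ifT// eqn_leq nk -ltnS ltn_ord.
Qed.

Lemma measurable_durations n (t : R) (k : 'I_n.+1) :
  measurable_fun setT (fun s : n.-tuple R => tnth (durations t s) k).
Proof.
under eq_fun do rewrite durations_nth.
case: ltnP => [kn|_].
  by under eq_fun do rewrite -(tnth_nth 0 _ (Ordinal kn)); exact: measurable_tnth.
by apply: measurable_funB => //; apply: measurable_sum => i; exact: measurable_tnth.
Qed.

Lemma admissible_durations n (t : R) (s : n.-tuple R) (k : 'I_n.+1) :
  admissible t s -> 0 <= tnth (durations t s) k <= t.
Proof.
move=> /andP[/forallP s0 st]; rewrite durations_nth; case: ltnP => [kn|_].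
  have -> : s`_k = tnth s (Ordinal kn) by rewrite (tnth_nth 0).
  rewrite ltW//= (le_trans _ (ltW st))// (bigD1 (Ordinal kn))//= lerDl.
  by apply: sumr_ge0 => i _; exact: ltW.
by rewrite subr_ge0 ltW//= lerBlDr lerDl sumr_ge0// => i _; exact: ltW.
Qed.

Lemma measurable_admissible n (t : R) : measurable [set s : n.-tuple R | admissible t s].
Proof.
rewrite (_ : [set _ | _] = (\bigcap_(j in [set` [set: 'I_n]%SET])
    (fun s : n.-tuple R => tnth s j) @^-1` `]0, +oo[%classic) `&`
    (fun s : n.-tuple R => \sum_(j < n) tnth s j) @^-1` `]-oo, t[%classic); last first.
  apply/seteqP; split => s /=; rewrite /admissible.
    move=> /andP[/forallP s0 st]; split; last by rewrite in_itv.
    by move=> j _ /=; rewrite in_itv/= andbT.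
  move=> [s0 st]; apply/andP; split; last by move: st; rewrite in_itv.
  by apply/forallP => j; have := s0 j; rewrite /= inE in_itv/= andbT; exact.
apply: measurableI.
  apply: fin_bigcap_measurable => [|j _]; first exact: finite_finset.
  by rewrite -[_ @^-1` _]setTI; exact: measurable_tnth.
rewrite -[_ @^-1` _]setTI; apply: measurable_sum => // i.
exact: measurable_tnth.
Qed.

Lemma simplex_monomialE n (t : R) e (s : n.-tuple R) :
  simplex_monomial t e s = \1_[set s | admissible t s] s *
    \prod_(k < n.+1) tnth (durations t s) k ^+ e k.
Proof.
rewrite /simplex_monomial indicE; case: ifPn => h.
  by rewrite mem_set// mul1r.
by rewrite memNset ?mul0r//; exact/negP.
Qed.

Lemma measurable_simplex_monomial n (t : R) e :
  measurable_fun setT (@simplex_monomial R n t e).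
Proof.
rewrite (_ : simplex_monomial t e = fun s : n.-tuple R =>
  \1_[set s | admissible t s] s * \prod_(k < n.+1) tnth (durations t s) k ^+ e k); last first.
  by apply/funext => s; rewrite simplex_monomialE.
apply: measurable_funM; first by apply: measurable_indic; exact: measurable_admissible.
apply: measurable_prod => k _; apply: measurable_funX.
exact: measurable_durations.
Qed.

Lemma simplex_monomial_ge0 n (t : R) e (s : n.-tuple R) : 0 <= simplex_monomial t e s.
Proof.
rewrite /simplex_monomial; case: ifPn => // ad; apply: prodr_ge0 => k _.
by rewrite exprn_ge0//; have /andP[] := admissible_durations k ad.
Qed.

Lemma bmeas_simplex_monomial n (t : R) e : bmeas (@simplex_monomial R n t e).
Proof.
split; first exact: measurable_simplex_monomial.
exists `|\prod_(k < n.+1) t ^+ e k| => s; rewrite ger0_norm ?simplex_monomial_ge0//.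
rewrite /simplex_monomial; case: ifPn => // ad; apply: le_trans (ler_norm _).
apply: ler_prod => k _; have /andP[d0 dt] := admissible_durations k ad.
by rewrite exprn_ge0//= lerXn2r// nnegrE (le_trans d0).
Qed.

Lemma simplex_monomialM n (t : R) e e' (s : n.-tuple R) :
  simplex_monomial t e s * simplex_monomial t e' s =
  simplex_monomial t (fun k => e k + e' k)%N s.
Proof.
rewrite /simplex_monomial; case: ifP => _; last by rewrite mul0r.
by rewrite -big_split; apply: eq_bigr => k _; rewrite exprD.
Qed.

Lemma simplex_monomial_cons n (t x : R) e (v : n.-tuple R) :
  simplex_monomial t e (tuple_cons (x, v)) =
  (\1_`]0, +oo[%classic x * x ^+ e 0%N) * simplex_monomial (t - x) (e \o S) v.
Proof.
have adE : admissible t (tuple_cons (x, v)) = (0 < x) && admissible (t - x) v.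
  rewrite /admissible forall_ord_recl big_ord_recl tnth_cons0/= -andbA; congr (_ && _).
  rewrite ltrBrDl; under [in RHS]eq_bigr do rewrite -(tnth_consS (x, v)).
  by congr (_ && _); apply: eq_forallb => j; rewrite tnth_consS.
rewrite /simplex_monomial adE indicE mem_setE in_itv/= andbT.
case: (0 < x) => /=; last by rewrite !mul0r.
rewrite mul1r; case: ifP => _; last by rewrite mulr0.
rewrite big_ord_recl; congr (_ * _); apply: eq_bigr => k _.
congr (_ ^+ _); rewrite !durations_nth/= /bump/= add1n ltnS.
case: ifP => // _; rewrite big_ord_recl tnth_cons0 opprD addrA; congr (_ - _).
by apply: eq_bigr => j _; rewrite tnth_consS.
Qed.

(** Dirichlet's integral: one Beta integral for each duration but the last. *)
Lemma dirichlet_integral n (t : R) e :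
  (\int[lebesgue_tuple n]_s (simplex_monomial t e s)%:E =
   (if 0 < t then (\prod_(k < n.+1) (e k)`!%:R) / (\sum_(k < n.+1) e k + n)`!%:R *
      t ^+ (\sum_(k < n.+1) e k + n) else 0)%:E)%E.
Proof.
elim: n => [|n IH] in t e *.
  rewrite [LHS](@integral_dirac _ _ ([tuple] : 0.-tuple R))//; last first.
    by apply/measurable_EFinP; exact: measurable_simplex_monomial.
  rewrite diracT mul1e /simplex_monomial /admissible big_ord0; congr EFin.
  have -> : [forall j, 0 < tnth ([tuple] : 0.-tuple R) j] by apply/forallP; case.
  rewrite !big_ord1 addn0 durations_nth big_ord0 subr0.
  by rewrite /=; case: ltP => _ //; rewrite divff ?mul1r// pnatr_eq0 -lt0n fact_gt0.
rewrite ge0_integral_tuple_cons; last 2 first.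
  by apply/measurable_EFinP; exact: measurable_simplex_monomial.
  by move=> s; rewrite lee_fin simplex_monomial_ge0.
under eq_integral.
  move=> x _; under eq_integral do rewrite simplex_monomial_cons EFinM.
  rewrite ge0_integralZl//; last 3 first.
    by apply/measurable_EFinP; exact: measurable_simplex_monomial.
    by move=> s _; rewrite lee_fin simplex_monomial_ge0.
    by rewrite lee_fin indicE mem_setE in_itv/= andbT; case: ltP => x0;
      rewrite ?mul0r// mul1r exprn_ge0// ltW.
  rewrite IH -EFinM; over.
set M := (\sum_(k < n.+1) (e \o S) k + n)%N.
set c : R := (\prod_(k < n.+1) ((e \o S) k)`!%:R) / M`!%:R.
pose F (x : R) := x ^+ e 0%N * (t - x) ^+ M.
have cF : continuous F.
  move=> x; apply: cvgM; first exact: exprn_continuous.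
  apply: (@continuousX _ (fun x => t - x)) => y; apply: cvgB; first exact: cvg_cst.
  exact: cvg_id.
transitivity (\int[mu]_(x in `]0%R, t[) (c * F x)%:E)%E.
  rewrite [RHS]integral_mkcond; apply: eq_integral => x _.
  rewrite patchE indicE !mem_setE !in_itv/= andbT subr_gt0.
  case: (ltP 0 x) => x0 /=; last by rewrite !mul0r.
  by case: ifP => xt; rewrite ?mulr0// mul1r /F; congr EFin; ring.
case: ltP => t0; last by rewrite set_itv_ge ?integral_set0// bnd_simp -leNgt.
have ccF : continuous (fun x => c * F x).
  by move=> x; apply: cvgM; [exact: cvg_cst|exact: cF].
have ic := continuous_integrable_itv 0 t ccF.
transitivity (\int[mu]_(x in `[0%R, t]) (c * F x)%:E)%E.
  rewrite [RHS]integral_itv_bndoo//.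
  apply: measurable_funTS; apply/measurable_EFinP; exact: continuous_measurable_fun.
rewrite -[LHS]fineK; last exact: integrable_fin_num.
congr EFin; transitivity (c * \int[mu]_(x in `[0, t]) F x).
  by apply: RintegralZl => //; exact: continuous_integrable_itv.
rewrite beta_integral// /c.
have -> : (\sum_(k < n.+2) e k + n.+1 = (e 0 + M).+1)%N.
  by rewrite big_ord_recl addnS addnA.
rewrite [in RHS]big_ord_recl; set p := \prod_(k < n.+1) _; rewrite -/p.
field.
by rewrite !pnatr_eq0 -!lt0n !fact_gt0.
Qed.

End dirichlet_integral.

(** * Coefficients of powers of generating functions *)

Section truncated_polynomials.
Context {R : comNzRingType}.
Implicit Types p q : {poly R}.

(** Equality of polynomials modulo ['X^(K + 1)]. *)
Definition agree (K : nat) p q := forall i, (i <= K)%N -> p`_i = q`_i.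

Lemma agreeM K p p' q q' : agree K p p' -> agree K q q' -> agree K (p * q) (p' * q').
Proof.
move=> pp qq i iK; rewrite !coefM; apply: eq_bigr => j _.
by rewrite pp ?qq// (leq_trans _ iK)// ?leq_subr// -ltnS.
Qed.

Lemma agreeX K p p' n : agree K p p' -> agree K (p ^+ n) (p' ^+ n).
Proof.
move=> pp; elim: n => [|n IH]; first by [].
by rewrite !exprS; exact: agreeM.
Qed.

Lemma agree_trans K p q s : agree K p q -> agree K q s -> agree K p s.
Proof. by move=> pq qs i iK; rewrite pq// qs. Qed.

Lemma agree_poly K (u v : nat -> R) n : (forall i, (i <= K)%N -> u i = v i) ->
  (K < n)%N -> agree K (\poly_(i < n) u i) (\poly_(i < K.+1) v i).
Proof.
move=> uv Kn i iK; rewrite !coef_poly ltnS iK (leq_ltn_trans iK Kn).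
exact: uv.
Qed.

Lemma coef_prod_poly n K (w : 'I_n -> nat -> R) :
  (\prod_(k < n) \poly_(m < K.+1) w k m)`_K =
  \sum_(f : {ffun 'I_n -> 'I_K.+1} | (\sum_k f k == K)%N) \prod_k w k (f k).
Proof.
under eq_bigr do rewrite poly_def.
rewrite bigA_distr_bigA coef_sum [RHS]big_mkcond/=; apply: eq_bigr => f _.
rewrite scaler_prod -(big_morph _ (@exprD {poly R} 'X) (expr0 _)) coefZ coefXn eq_sym.
by case: ifP => _; rewrite ?mulr1 ?mulr0.
Qed.

(** A power of an even generating function, as a power of a generating function in the
    square of the variable. *)
Lemma coef_even_poly_exp (w u : nat -> R) N K :
  (forall m, odd m -> w m = 0) -> (forall k, w k.*2 = u k) ->
  ((\poly_(m < K.+1) w m) ^+ N)`_K =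
  if odd K then 0 else ((\poly_(k < K./2.+1) u k) ^+ N)`_(K./2).
Proof.
have half_le m : (m./2 <= m)%N.
  by rewrite -{2}(odd_double_half m) -addnn addnA leq_addl.
move=> w0 wu; pose p := \poly_(k < K.+1) u k.
have wp : agree K (\poly_(m < K.+1) w m) (p \Po 'X^2).
  move=> i iK; rewrite coef_poly ltnS iK coef_comp_poly_Xn// dvdn2.
  case: ifPn => [ei|]; last by rewrite negbK => /w0.
  rewrite divn2 coef_poly ltnS (leq_trans (half_le i) iK).
  by rewrite -wu -[in LHS](odd_double_half i) (negbTE ei).
rewrite (agreeX N wp (leqnn K)) -rmorphXn/= coef_comp_poly_Xn// dvdn2 divn2.
case: odd => //=; apply: (agreeX N (K := K./2)) => //.
by apply: agree_poly => //; rewrite ltnS half_le.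
Qed.

End truncated_polynomials.

Section power_series_identities.
Context {R : realType}.

(** The exponential of a sum is the product of the exponentials, up to degree [K]. *)
Lemma exp_poly_sum K (I : Type) (s : seq I) (x : I -> R) :
  agree K (\prod_(k <- s) \poly_(m < K.+1) divided_pow (x k) m)
    (\poly_(m < K.+1) divided_pow (\sum_(k <- s) x k) m).
Proof.
elim: s => [|k s IH] i iK.
  rewrite !big_nil coef1 coef_poly ltnS iK /divided_pow.
  case: i {iK} => [|i]; first by rewrite expr0 fact0 divr1.
  by rewrite expr0n mul0r.
rewrite !big_cons (agreeM (fun _ _ => erefl) IH)// coefM coef_poly ltnS iK.
rewrite addrC -divided_powD; apply: eq_bigr => j _.
have ji : (j <= i)%N by rewrite -ltnS.
by rewrite !coef_poly !ltnS (leq_trans ji iK) (leq_trans (leq_subr _ _) iK) mulrC.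
Qed.

(** The multinomial theorem. *)
Lemma multinomial_expansion n K (x : 'I_n -> R) :
  divided_pow (\sum_k x k) K =
  \sum_(f : {ffun 'I_n -> 'I_K.+1} | (\sum_k f k == K)%N)
    \prod_k divided_pow (x k) (f k).
Proof.
rewrite -(coef_prod_poly K (fun k m => divided_pow (x k) m)).
by rewrite (exp_poly_sum _ x (leqnn K)) coef_poly ltnSn.
Qed.

(** [negbin l k] is the coefficient of [z ^ k] in [(1 - z) ^ (- l)]. *)
Definition negbin (l : R) (k : nat) : R := (\prod_(i < k) (l + i%:R)) / k`!%:R.

Lemma negbin0 l : negbin l 0 = 1.
Proof. by rewrite /negbin big_ord0 fact0 divr1. Qed.

Lemma negbinS l k : k.+1%:R * negbin l k.+1 = (l + k%:R) * negbin l k.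
Proof.
rewrite /negbin big_ord_recr factS natrM/=; field.
by rewrite nat1r !pnatr_eq0 -lt0n fact_gt0.
Qed.

(** The Chu-Vandermonde identity. *)
Lemma negbinD (a b : R) k :
  \sum_(j < k.+1) negbin a (k - j) * negbin b j = negbin (a + b) k.
Proof.
elim: k => [|k IH]; first by rewrite big_ord1 !negbin0 mulr1.
have k0 : k.+1%:R != 0 :> R by rewrite pnatr_eq0.
apply: (mulfI k0); rewrite negbinS -IH !mulr_sumr.
have split_k (j : 'I_k.+2) : k.+1%:R * (negbin a (k.+1 - j) * negbin b j) =
    (k.+1 - j)%:R * negbin a (k.+1 - j) * negbin b j +
    negbin a (k.+1 - j) * (j%:R * negbin b j).
  by rewrite natrB -1?ltnS//; ring.
under eq_bigr do rewrite split_k.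
rewrite big_split/= big_ord_recr/= subnn mulr0n !mul0r addr0.
rewrite [X in _ + X]big_ord_recl/= mulr0n mul0r mulr0 add0r.
rewrite -big_split/=; apply: eq_bigr => j _.
have jk : (j <= k)%N by rewrite -ltnS.
by rewrite /bump/= add1n subSS subSn// !negbinS natrB//; ring.
Qed.

(** Truncation of [(1 - r z) ^ (- l)]. *)
Definition negbin_poly K (r l : R) : {poly R} := \poly_(k < K.+1) (negbin l k * r ^+ k).

Lemma negbin_polyD K r a b :
  agree K (negbin_poly K r a * negbin_poly K r b) (negbin_poly K r (a + b)).
Proof.
move=> i iK; rewrite coefM coef_poly ltnS iK addrC -negbinD mulr_suml.
apply: eq_bigr => j _; have ji : (j <= i)%N by rewrite -ltnS.
rewrite !coef_poly !ltnS (leq_trans ji iK) (leq_trans (leq_subr _ _) iK).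
have -> : r ^+ i = r ^+ (i - j) * r ^+ j by rewrite -exprD subnK.
by ring.
Qed.

Lemma negbin_polyX K r l N : agree K (negbin_poly K r l ^+ N) (negbin_poly K r (N%:R * l)).
Proof.
elim: N => [|N IH].
  move=> i iK; rewrite expr0 coef1 coef_poly ltnS iK mul0r.
  case: i {iK} => [|i]; first by rewrite negbin0 expr0 mulr1.
  by rewrite /negbin big_ord_recl/= addr0 !mul0r.
rewrite exprS -natr1 mulrDl mul1r addrC.
apply: agree_trans (negbin_polyD r l (N%:R * l)).
by apply: agreeM => // i.
Qed.

(** The coefficients of [(1 - r z) ^ (- l) (1 + b z / (1 - r z))]. *)
Definition projection_coef (r l b : R) (k : nat) : R :=
  negbin l k * r ^+ k +
  b * (if k is k'.+1 then negbin (l + 1) k' * r ^+ k' else 0).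

(** Binomial expansion of the [N]-th power of
    [(1 - r z) ^ (- l) + b z (1 - r z) ^ (- (l + 1))]. *)
Lemma coef_projection_exp (r l b : R) N k :
  ((\poly_(i < k.+1) projection_coef r l b i) ^+ N)`_k =
  \sum_(j < N.+1) 'C(N, j)%:R * b ^+ (N - j) *
    (if (k < N - j)%N then 0 else
     negbin ((N - j)%:R * (l + 1) + j%:R * l) (k - (N - j)) * r ^+ (k - (N - j))).
Proof.
have pE : agree k (\poly_(i < k.+1) projection_coef r l b i)
    (b *: ('X * negbin_poly k r (l + 1)) + negbin_poly k r l).
  move=> i ik; rewrite coefD coefZ coefXM !coef_poly ltnS ik addrC /projection_coef.
  by case: i ik => // i ik; rewrite ltnS (ltnW ik).
rewrite (agreeX N pE (leqnn k)) exprDn coef_sum; apply: eq_bigr => j _.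
rewrite coefMn exprZn exprMn -scalerAl coefZ -(mulrA 'X^_) coefXnM -[LHS]mulr_natl.
rewrite mulrA; congr (_ * _); case: ltnP => // jk.
have kk : (k - (N - j) <= k)%N by rewrite leq_subr.
rewrite (agreeM (negbin_polyX r (l + 1) (N - j)) (negbin_polyX r l j) kk).
by rewrite negbin_polyD// coef_poly ltnS kk.
Qed.

End power_series_identities.

(** * Moments of the position *)

Section directions.
Context {R : realType}.
Local Notation hg := (@half_gamma R).

Lemma Gamma_ge0 (x : R) : 0 <= Gamma x.
Proof.
by apply: Rintegral_ge0 => s _; rewrite mulr_ge0 ?powR_ge0 ?expR_ge0.
Qed.

Lemma angles_densityE d (th : (d.+1).-tuple R) : @angles_density R d.+2 th =
  Gamma (1 + d.+2%:R / 2) / (2 * pi `^ ((d.+2%:R - 1) / 2) * Gamma (3 / 2)) *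
  @angle_weight R d.+2 th.
Proof. by rewrite /angles_density /angle_weight; case: ifP; rewrite ?mulr0. Qed.

Lemma measurable_angle_weight d : measurable_fun setT (@angle_weight R d.+1).
Proof.
have := measurable_int _ (integrable_angle_moment (0 : 'rV[R]_d.+1) 0).
by move/measurable_EFinP; under eq_fun do rewrite expr0 mul1r.
Qed.

Lemma angle_weight_ge0 d (th : (d.+1).-tuple R) : 0 <= @angle_weight R d.+2 th.
Proof.
rewrite /angle_weight; case: ifPn => // /forallP h; apply: prodr_ge0 => i _.
have := h i; rewrite /angle_bound; case: eqP => [->|_] /andP[h0 h1].
  by rewrite subKn// sqr_ge0.
by rewrite exprn_ge0// sin_ge0_pi// h0.
Qed.

Lemma bmeas_direction d (i : 'I_d.+2) :
  bmeas (fun th : (d.+1).-tuple R => @direction R d.+2 th 0 i).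
Proof.
have bs (m : 'I_d.+1) : bmeas (fun th : (d.+1).-tuple R => sin (tnth th m)).
  split; last by exists 1 => th; rewrite ler_norml sin_geN1 sin_le1.
  apply: measurableT_comp; last exact: measurable_tnth.
  by apply: continuous_measurable_fun; exact: continuous_sin.
have bc (m : 'I_d.+1) : bmeas (fun th : (d.+1).-tuple R => cos (tnth th m)).
  split; last by exists 1 => th; rewrite ler_norml cos_geN1 cos_le1.
  apply: measurableT_comp; last exact: measurable_tnth.
  by apply: continuous_measurable_fun; exact: continuous_cos.
under eq_fun do rewrite mxE; apply: bmeasM; first exact: bmeas_prod.
case: ltnP => [id|_]; last exact: bmeas_cst.
by under eq_fun do rewrite -(tnth_nth 0 _ (Ordinal id)); exact: bc.
Qed.

Lemma bmeas_dot_direction d (alpha : 'rV[R]_d.+2) :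
  bmeas (fun th : (d.+1).-tuple R => dot alpha (@direction R d.+2 th)).
Proof.
apply: bmeas_sum => i; apply: bmeasM; first exact: bmeas_cst.
exact: bmeas_direction.
Qed.

Context dT (T : measurableType dT) (P : probability T R).

Lemma direction_moments d (X : {RV P >-> (d.+1).-tuple R}) (alpha : 'rV[R]_d.+2) :
  has_density X (@angles_density R d.+2) ->
  (forall K, odd K -> \int[P]_w (dot alpha (@direction R d.+2 (X w)) ^+ K) = 0) /\
  (forall k, \int[P]_w (dot alpha (@direction R d.+2 (X w)) ^+ k.*2) =
     hg d.+3 * (k.*2`!%:R / (4 ^+ k * hg (d.+3 + k.*2))) *
     moment_poly (dot alpha alpha) (alpha 0 ord_max ^+ 2) k).
Proof.
move=> hX; set c : R := Gamma (1 + d.+2%:R / 2) /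
  (2 * pi `^ ((d.+2%:R - 1) / 2) * Gamma (3 / 2)).
have cE : @angles_density R d.+2 = fun th => c * @angle_weight R d.+2 th.
  by apply/funext => th; exact: angles_densityE.
have c0 : 0 <= c by rewrite divr_ge0 ?mulr_ge0 ?Gamma_ge0 ?powR_ge0.
have EK K : \int[P]_w (dot alpha (@direction R d.+2 (X w)) ^+ K) = c * angle_moment alpha K.
  have bh : bmeas (fun th => dot alpha (@direction R d.+2 th) ^+ K).
    by apply: bmeasX; exact: bmeas_dot_direction.
  rewrite (@expectation_density _ _ _ P _ X (@angles_density R d.+2) _ _ hX _ bh).
  - rewrite cE; under eq_Rintegral do rewrite mulrCA.
    by rewrite RintegralZl//; exact: integrable_angle_moment.
  - by move=> th; rewrite cE mulr_ge0// angle_weight_ge0.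
  - by rewrite cE; apply: measurable_funM => //; exact: measurable_angle_weight.
have [C HC] := angle_moment_closed (R := R) d; have [Ho He] := HC alpha.
split=> [K oK|k]; first by rewrite EK Ho// mulr0.
have h : 1 = c * angle_moment alpha 0.*2.
  rewrite -EK; under eq_Rintegral do rewrite expr0.
  by rewrite /Rintegral integral_cst// mul1e [X in fine X]probability_setT.
have h0 := half_gamma_neq0 (R := R) d.+3.
(* the moment of order 0 is the total mass, 1 *)
have cC : c * C = hg d.+3.
  rewrite -[RHS]mul1r [in RHS]h He addn0 /moment_poly /divided_pow expr0 fact0.
  by rewrite mulr0 addr0 divr1; field.
by rewrite EK He mulrA mulrA cC.
Qed.

Lemma times_densityE n d (t : R) (s : n.-tuple R) : times_density d t s =
  (n.+1 * d.+1).-1`!%:R / d`!%:R ^+ n.+1 / t ^+ (n.+1 * d.+1).-1 *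
  simplex_monomial t (fun=> d) s.
Proof.
rewrite /times_density /simplex_monomial /admissible; case: ifP => _; last by rewrite mulr0.
by rewrite Gamma_nat -[(n.+1 * d.+1)%N]prednK ?muln_gt0// Gamma_nat/=; ring.
Qed.

(** The joint moments of the durations; the indicator of the simplex in
    [simplex_monomial] is almost surely 1. *)
Lemma duration_moments n d (t : R) (tau : {RV P >-> n.-tuple R}) e : 0 < t ->
  has_density tau (times_density d t) ->
  \int[P]_w (simplex_monomial t e (tau w)) =
  (n.+1 * d.+1).-1`!%:R / ((n.+1 * d.+1).-1 + \sum_(k < n.+1) e k)`!%:R *
  t ^+ (\sum_(k < n.+1) e k) * \prod_(k < n.+1) ((e k + d)`!%:R / d`!%:R).
Proof.
move=> t0 htau; set A := (n.+1 * d.+1).-1.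
pose c : R := A`!%:R / d`!%:R ^+ n.+1 / t ^+ A.
have cE : @times_density R d n t = fun s => c * simplex_monomial t (fun=> d) s.
  by apply/funext => s; exact: times_densityE.
have c0 : 0 <= c by rewrite !divr_ge0 ?exprn_ge0// ltW.
rewrite (@expectation_density _ _ _ P _ tau (times_density d t) _ _ htau _
  (bmeas_simplex_monomial n t e)).
- rewrite cE; under eq_Rintegral do rewrite mulrCA simplex_monomialM.
  set g := simplex_monomial t _.
  have gE := dirichlet_integral n t (fun k => (e k + d)%N).
  rewrite RintegralZl//; last first.
    apply/integrableP; split.
      by apply/measurable_EFinP; exact: measurable_simplex_monomial.
    under eq_integral do rewrite gee0_abs ?lee_fin ?simplex_monomial_ge0//.
    by rewrite gE ltry.
  rewrite {1}/Rintegral gE t0/= big_split/= sum_nat_const card_ord.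
  have -> : (\sum_(i < n.+1) e i + n.+1 * d + n = A + \sum_(k < n.+1) e k)%N.
    by rewrite /A mulnS; lia.
  rewrite exprD prodf_div prodr_const card_ord /c; field.
  by rewrite !expf_neq0 ?gt_eqF// ?pnatr_eq0 -?lt0n ?fact_gt0.
- by move=> s; rewrite cE mulr_ge0// simplex_monomial_ge0.
- by rewrite cE; apply: measurable_funM => //; exact: measurable_simplex_monomial.
Qed.

End directions.

Section flight_moments.
Context {R : realType}.
Local Notation hg := (@half_gamma R).

(** The functional equation of the Gamma function, iterated. *)
Lemma half_gamma_shift d k :
  hg (d + k.*2) = hg d * \prod_(i < k) (d.+1%:R / 2 + i%:R).
Proof.
elim: k => [|k IH]; first by rewrite addn0 big_ord0 mulr1.
rewrite doubleS !addnS half_gammaSS IH big_ord_recr/= -addSn natrD -mul2n natrM.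
by field.
Qed.

(** The moment of order [m] of the projection of a direction in dimension [d] on
    a vector of squared norm [r] whose last coordinate has square [a]. *)
Definition projection_moment d (r a : R) (m : nat) : R :=
  if odd m then 0 else
  hg d.+1 * (m`!%:R / (4 ^+ m./2 * hg (d.+1 + m))) * moment_poly r a m./2.

(** The factor of a moment of the position contributed by one displacement. *)
Definition step_coef d (r a : R) (m : nat) : R :=
  (m + d)`!%:R / (d`!%:R * m`!%:R) * projection_moment d r a m.

(** The duplication formula absorbs the factorials: the factors of the even orders are
    the coefficients of an algebraic function. *)
Lemma step_coef_even d (r a : R) k :
  step_coef d r a k.*2 = projection_coef r (d.+1%:R / 2) (d.+1%:R * a) k.
Proof.
have f0 i : i`!%:R != 0 :> R by rewrite pnatr_eq0 -lt0n fact_gt0.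
have p0 : Num.sqrt pi != 0 :> R by rewrite gt_eqF// sqrtr_gt0 pi_gt0.
have fE m : m`!%:R = hg m * hg m.+1 * 2 ^+ m / Num.sqrt pi.
  by rewrite half_gamma_duplication; field; rewrite p0 expf_neq0.
have -> : step_coef d r a k.*2 =
    (\prod_(i < k) (d.+1%:R / 2 + i%:R)) * moment_poly r a k.
  rewrite /step_coef /projection_moment odd_double doubleK.
  rewrite (addnC k.*2) (fE d) (fE (d + k.*2)%N) exprD -mul2n exprM mul2n.
  rewrite (_ : (2 : R) ^+ 2 = 4); last by rewrite -natrX.
  rewrite addSn (half_gamma_shift d); field.
  by rewrite f0 p0 !half_gamma_neq0 !expf_neq0.
rewrite /moment_poly /projection_coef mulrDr /negbin /divided_pow; congr (_ + _).
  by rewrite mulrA mulrAC.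
case: k => [|k]; first by rewrite !mulr0.
rewrite big_ord_recl/= addr0.
rewrite (eq_bigr (fun i : 'I_k => d.+1%:R / 2 + 1 + i%:R)); last first.
  by move=> i _; rewrite /bump/= natrD addrA.
by field; rewrite f0.
Qed.

Lemma big_option (I : finType) (g : option I -> R) :
  \prod_i g i = g None * \prod_k g (Some k).
Proof.
rewrite (bigD1 None)//=; congr (_ * _); rewrite (reindex_omap some id)/=; last by case.
by apply: eq_bigl => k; rewrite eqxx.
Qed.

Context dT (T : measurableType dT) (P : probability T R) (d n : nat) (c t : R).
Context (tau : {RV P >-> n.-tuple R}) (theta : 'I_n.+1 -> {RV P >-> (d.+1).-tuple R}).
Hypotheses (t0 : 0 < t) (hX : @random_flight R _ T P d.+2 n t tau theta).
Variable alpha : 'rV[R]_d.+2.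

Let y k w : R := dot alpha (@direction R d.+2 (theta k w)).
Let r := dot alpha alpha.
Let a := alpha 0 ord_max ^+ 2.

Lemma dot_position w : dot alpha (@position R _ T P d.+2 n c t tau theta w) =
  c * \sum_k tnth (durations t (tau w)) k * y k w.
Proof.
rewrite /dot /position mulr_sumr.
under eq_bigr do rewrite !mxE summxE !mulr_sumr.
rewrite exchange_big/=; apply: eq_bigr => k _.
rewrite /y /dot !mulr_sumr; apply: eq_bigr => i _.
by rewrite !mxE; ring.
Qed.

Lemma bmeas_projection k : bmeas (y k).
Proof.
have [m [M hM]] := bmeas_dot_direction alpha; split; last by exists M => w; exact: hM.
exact: (measurableT_comp m (measurable_funPT (theta k))).
Qed.

Lemma bmeas_duration_monomial e : bmeas (fun w => simplex_monomial t e (tau w)).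
Proof.
have [m [M hM]] := bmeas_simplex_monomial n t e; split; last by exists M => w; exact: hM.
exact: (measurableT_comp m (measurable_funPT tau)).
Qed.

(** Independence of the durations and of the directions. *)
Lemma flight_independence e (m : 'I_n.+1 -> nat) :
  \int[P]_w (simplex_monomial t e (tau w) * \prod_k y k w ^+ m k) =
  (\int[P]_w simplex_monomial t e (tau w)) * \prod_k \int[P]_w (y k w ^+ m k).
Proof.
pose f (i : option 'I_n.+1) w : R :=
  if i is Some k then y k w ^+ m k else simplex_monomial t e (tau w).
have := @independent_expectation_prod _ T R P _ _ f (flight_independent hX).
rewrite big_option/= => <-.
- by apply: eq_Rintegral => w _; rewrite big_option.
- case=> [k|] A [B mB <-]; rewrite setTI -[X in measurable X]setTI.
    exact: (measurable_funPT (theta k)).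
  exact: (measurable_funPT tau).
- case=> [k|] B mB /=; rewrite /sigma_of /preimage_set_system/=.
    exists ((fun th => dot alpha (@direction R d.+2 th) ^+ m k) @^-1` B); last first.
      by rewrite setTI.
    rewrite -[X in measurable X]setTI.
    exact: (bmeasX (m k) (bmeas_dot_direction alpha)).1.
  exists (simplex_monomial t e @^-1` B); last by rewrite setTI.
  by rewrite -[X in measurable X]setTI; exact: measurable_simplex_monomial.
- case=> [k|]; last exact: bmeas_duration_monomial.
  by apply: bmeasX; exact: bmeas_projection.
Qed.

Lemma projection_momentE k m : \int[P]_w (y k w ^+ m) = projection_moment d.+2 r a m.
Proof.
have [Ho He] := direction_moments alpha (flight_angles hX k).
rewrite /projection_moment; case: ifPn => om; first exact: Ho.
have mE : m = m./2.*2 by rewrite -[LHS](odd_double_half m) (negbTE om).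
by rewrite {1}mE He -mE.
Qed.

(** The moments of the projection of the position, on the event of probability one
    that the durations are positive, where it is bounded. *)
Lemma flight_moment K :
  \int[P]_w (\1_[set s | admissible t s] (tau w) *
    divided_pow (dot alpha (@position R _ T P d.+2 n c t tau theta w)) K) =
  (c * t) ^+ K *
  ((n.+1 * d.+3).-1`!%:R / ((n.+1 * d.+3).-1 + K)`!%:R) *
  (if odd K then 0 else
   ((\poly_(k < K./2.+1) projection_coef r (d.+3%:R / 2) (d.+3%:R * a) k) ^+ n.+1)`_(K./2)).
Proof.
have f0 i : i`!%:R != 0 :> R by rewrite pnatr_eq0 -lt0n fact_gt0.
(* exponents are functions of natural numbers in [simplex_monomial] *)
pose e (f : {ffun 'I_n.+1 -> 'I_K.+1}) (k : nat) : nat := f (inord k).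
have eE f (k : 'I_n.+1) : e f k = f k by rewrite /e inord_val.
pose term (f : {ffun 'I_n.+1 -> 'I_K.+1}) w : R := (c ^+ K / \prod_k (f k)`!%:R) *
  (simplex_monomial t (e f) (tau w) * \prod_k y k w ^+ f k).
pose fs := [seq f : {ffun 'I_n.+1 -> 'I_K.+1} <- index_enum _ | (\sum_k f k == K)%N].
have pointwise w : \1_[set s | admissible t s] (tau w) *
    divided_pow (dot alpha (@position R _ T P d.+2 n c t tau theta w)) K =
    \sum_(f <- fs) term f w.
  rewrite /fs big_filter dot_position.
  have -> : divided_pow (c * \sum_k tnth (durations t (tau w)) k * y k w) K =
      c ^+ K * divided_pow (\sum_k tnth (durations t (tau w)) k * y k w) K.
    by rewrite /divided_pow exprMn mulrA.
  rewrite multinomial_expansion !mulr_sumr; apply: eq_bigr => f _.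
  rewrite /term simplex_monomialE /divided_pow prodf_div.
  under eq_bigr do rewrite exprMn.
  rewrite big_split/=.
  have -> : \prod_(k < n.+1) tnth (durations t (tau w)) k ^+ e f k =
      \prod_(k < n.+1) tnth (durations t (tau w)) k ^+ f k.
    by apply: eq_bigr => k _; rewrite eE.
  by ring.
have bt f : bmeas (term f).
  apply: bmeasM; first exact: bmeas_cst.
  apply: bmeasM; first exact: bmeas_duration_monomial.
  by apply: bmeas_prod => k; apply: bmeasX; exact: bmeas_projection.
under eq_Rintegral do rewrite pointwise.
rewrite Rintegral_sum => [|f]; last exact: bmeas_integrable.
rewrite /fs big_filter.
pose w m := step_coef d.+2 r a m.
have wodd m : odd m -> w m = 0.
  by move=> om; rewrite /w /step_coef /projection_moment om mulr0.
rewrite -(coef_even_poly_exp n.+1 K wodd (step_coef_even d.+2 r a)).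
have -> : (\poly_(m < K.+1) w m) ^+ n.+1 = \prod_(k < n.+1) \poly_(m < K.+1) w m.
  by rewrite prodr_const card_ord.
rewrite (coef_prod_poly K (fun _ m => w m)) mulr_sumr; apply: eq_bigr => f /eqP fK.
rewrite /term RintegralZl//; last first.
  apply: bmeas_integrable; apply: bmeasM; first exact: bmeas_duration_monomial.
  by apply: bmeas_prod => k; apply: bmeasX; exact: bmeas_projection.
rewrite flight_independence (duration_moments _ t0 (flight_times hX)).
have sE : (\sum_(k < n.+1) e f k = K)%N by rewrite -[RHS]fK; apply: eq_bigr => k _; rewrite eE.
rewrite sE.
have -> : \prod_(k < n.+1) \int[P]_w (y k w ^+ f k) =
    \prod_(k < n.+1) projection_moment d.+2 r a (f k).
  by apply: eq_bigr => k _; exact: projection_momentE.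
have -> : \prod_(k < n.+1) ((e f k + d.+2)`!%:R / d.+2`!%:R) =
    \prod_(k < n.+1) ((f k + d.+2)`!%:R / d.+2`!%:R) :> R.
  by apply: eq_bigr => k _; rewrite eE.
rewrite /w /step_coef.
have -> : \prod_(k < n.+1) ((f k + d.+2)`!%:R / (d.+2`!%:R * (f k)`!%:R) *
      projection_moment d.+2 r a (f k)) =
    \prod_(k < n.+1) ((f k + d.+2)`!%:R / d.+2`!%:R) / \prod_(k < n.+1) (f k)`!%:R *
    \prod_(k < n.+1) projection_moment d.+2 r a (f k).
  rewrite -prodf_div -big_split; apply: eq_bigr => k _ /=.
  by field; rewrite !f0.
by rewrite exprMn; ring.
Qed.

End flight_moments.

(** * Characteristic functions of bounded variables *)

Section characteristic_series.
Context dT (T : measurableType dT) (R : realType) (P : probability T R).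

Lemma divided_pow_ge0 (x : R) m : 0 <= x -> 0 <= divided_pow x m.
Proof. by move=> x0; rewrite divr_ge0 ?exprn_ge0. Qed.

Lemma sum_divided_pow_le (x : R) n : 0 <= x -> \sum_(m < n) divided_pow x m <= expR x.
Proof.
move=> x0; rewrite -(big_mkord predT (divided_pow x)).
apply: (@nondecreasing_cvgn_le _ (series (exp_coeff x))).
  apply/nondecreasing_seqP => k; rewrite /series/= big_nat_recr//= lerDl.
  exact: divided_pow_ge0.
exact: is_cvg_series_exp_coeff.
Qed.

Lemma sum_divided_pow_parity_le (x : R) e n : (e <= 1)%N -> 0 <= x ->
  \sum_(k < n) divided_pow x (k.*2 + e) <= expR x.
Proof.
move=> e1 x0; apply: le_trans (sum_divided_pow_le n.*2 x0).
elim: n => [|n IH]; first by rewrite !big_ord0.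
rewrite doubleS 3!big_ord_recr/= -addrA lerD//.
by case: e e1 {IH} => [|[|//]] _; rewrite ?addn0 ?addn1 ?lerDl ?lerDr divided_pow_ge0.
Qed.

Section bounded_on.
Variables (A : set T) (Z : T -> R) (M : R).
Hypotheses (mA : measurable A) (mZ : measurable_fun setT Z).
Hypothesis ZM : forall w, A w -> `|Z w| <= M.

Lemma bmeas_indic_comp (h : R -> R) (B : R) : measurable_fun setT h ->
  (forall x, `|x| <= M -> `|h x| <= B) -> bmeas (fun w => \1_A w * h (Z w)).
Proof.
move=> mh hB; split.
  apply: measurable_funM; first exact: measurable_indic.
  exact: measurableT_comp.
exists `|B| => w; rewrite indicE; case: (boolP (w \in A)) => [/set_mem Aw|_].
  by rewrite mul1r (le_trans (hB _ (ZM Aw)))// ler_norm.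
by rewrite mul0r normr0.
Qed.

Lemma measurable_divided_pow m : measurable_fun setT (fun x : R => divided_pow x m).
Proof.
by rewrite /divided_pow; apply: measurable_funM => //; exact: measurable_funX.
Qed.

Lemma normr_divided_pow (x : R) m : `|divided_pow x m| = divided_pow `|x| m.
Proof. by rewrite /divided_pow normrM normrX normfV normr_nat. Qed.

Lemma bmeas_divided_pow m : bmeas (fun w => \1_A w * divided_pow (Z w) m).
Proof.
apply: (bmeas_indic_comp (measurable_divided_pow m) (B := divided_pow M m)) => x xM.
by rewrite normr_divided_pow ler_wpM2r ?invr_ge0// lerXn2r// nnegrE// (le_trans _ xM).
Qed.

(** Integration term by term of a power series with coefficients
    [(-1) ^ k / (2 k + e)!], where [e] is 0 for the cosine and 1 for the sine, on an
    event where the variable is bounded. By dominated convergence. *)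
Lemma cvg_expectation_series (g : R -> R) e : (e <= 1)%N -> measurable_fun setT g ->
  (forall x, series (fun k => (-1) ^+ k * divided_pow x (k.*2 + e)) @ \oo --> g x) ->
  series (fun k => (-1) ^+ k * \int[P]_w (\1_A w * divided_pow (Z w) (k.*2 + e)))
    @ \oo --> \int[P]_w (\1_A w * g (Z w)).
Proof.
move=> e1 mg gE.
pose u k w : R := (-1) ^+ k * (\1_A w * divided_pow (Z w) (k.*2 + e)).
have bu k : bmeas (u k) by apply: bmeasM; [exact: bmeas_cst|exact: bmeas_divided_pow].
pose f n w : R := \sum_(k < n) u k w.
have bf n : bmeas (f n) by apply: bmeas_sum => k; exact: bu.
have fE n w : f n w = \1_A w * series (fun k => (-1) ^+ k * divided_pow (Z w) (k.*2 + e)) n.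
  rewrite /f /series/= big_mkord mulr_sumr; apply: eq_bigr => k _.
  by rewrite /u mulrCA.
have E n : (\int[P]_w (f n w)%:E)%E = ((series (fun k => (-1) ^+ k *
    \int[P]_w (\1_A w * divided_pow (Z w) (k.*2 + e))) n)%:E)%E.
  rewrite -[LHS]fineK; last by apply: integrable_fin_num => //; exact: bmeas_integrable.
  congr EFin; rewrite -/(Rintegral _ _ _) Rintegral_sum => [|k]; last exact: bmeas_integrable.
  rewrite /series/= big_mkord; apply: eq_bigr => k _.
  by rewrite RintegralZl//; apply: bmeas_integrable; exact: bmeas_divided_pow.
have dom n w : `|f n w| <= expR M + 1.
  rewrite fE indicE; case: (boolP (w \in A)) => [/set_mem Aw|_]; last first.
    by rewrite mul0r normr0 addr_ge0// expR_ge0.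
  rewrite mul1r /series/= big_mkord (le_trans (ler_norm_sum _ _ _))//.
  under eq_bigr do rewrite normrM normrX normrN1 expr1n mul1r normr_divided_pow.
  rewrite (le_trans (sum_divided_pow_parity_le n e1 (normr_ge0 _)))//.
  by rewrite (@le_trans _ _ (expR M)) ?ler_expR ?ZM// lerDl.
have mf n : measurable_fun setT (fun w => (f n w)%:E) by apply/measurable_EFinP; exact: (bf n).1.
have mG : measurable_fun setT (fun w => (\1_A w * g (Z w))%:E).
  apply/measurable_EFinP; apply: measurable_funM; first exact: measurable_indic.
  exact: measurableT_comp.
have ptw : {ae P, forall w, [set: T] w ->
    (f n w)%:E @[n --> \oo] --> (\1_A w * g (Z w))%:E}.
  apply: aeW => w _.
  have h : f n w @[n --> \oo] --> \1_A w * g (Z w).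
    by under eq_fun do rewrite fE; apply: cvgM; [exact: cvg_cst|exact: gE].
  by apply: cvg_EFin => //; exact: nearW.
have ic : P.-integrable setT (cst (expR M + 1)%:E) by exact: finite_measure_integrable_cst.
have domE : {ae P, forall w n, [set: T] w -> (`|(f n w)%:E| <= cst (expR M + 1)%:E w)%E}.
  by apply: aeW => w n _; rewrite lee_fin.
have [iG _] := dominated_convergence measurableT mf mG ptw ic domE.
under eq_fun do rewrite E.
rewrite -[X in _ --> X -> _]fineK; last exact: integrable_fin_num.
by move/fine_cvg.
Qed.

(** Events of probability one may be inserted in an expectation. *)
Lemma expectation_indic_full (f : T -> R) : P (~` A) = 0%E -> bmeas f ->
  \int[P]_w f w = \int[P]_w (\1_A w * f w).
Proof.
move=> A0 bf; rewrite /Rintegral; congr fine; apply: ae_eq_integral => //.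
- exact/measurable_EFinP/bf.1.
- by apply/measurable_EFinP/measurable_funM; [exact: measurable_indic|exact: bf.1].
- exists (~` A); split => //; first exact: measurableC.
  move=> w /=; apply: contra_not => nAw _; by rewrite indicE mem_set ?mul1r//; exact: contrapT.
Qed.

End bounded_on.

End characteristic_series.

(** * Bessel functions of half-integer order *)

Lemma cvg_from_shift (R : realType) p (u v : nat -> R) (l : R) :
  (forall n, u (n + p)%N = v n) -> v n @[n --> \oo] --> l -> u n @[n --> \oo] --> l.
Proof.
by move=> uv vl; rewrite -(cvg_shiftn p u) (_ : [sequence _]_n = v)//; exact/funext.
Qed.

Section bessel.
Context {R : realType}.
Local Notation hg := (@half_gamma R).

Lemma half_gamma_ge m k : hg m.+1 <= hg (k.*2 + m.+1).
Proof.
elim: k => [|k IH]; first by rewrite add0n.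
rewrite doubleS !addSn half_gammaSS (le_trans IH)// ler_peMl ?(ltW (half_gamma_gt0 _))//.
by rewrite ler_pdivlMr// mul1r ler_nat !ltnS addnS.
Qed.

(** With [x] for half of the variable, the term of index [k] of the Bessel series of
    order [(L - 1) / 2], without the common factor [x ^ ((L - 1) / 2)]. *)
Definition bessel_coef (L : nat) (x : R) (k : nat) : R :=
  (-1) ^+ k / (k`!%:R * hg (k.*2 + L)) * x ^+ k.*2.

Lemma is_cvg_bessel_coef L (x : R) : cvgn (series (bessel_coef L.+1 x)).
Proof.
have hg0 m : 0 <= hg m by rewrite ltW// half_gamma_gt0.
apply: normed_cvg.
apply: (@series_le_cvg _ _ (fun k => (hg L.+1)^-1 * exp_coeff (x ^+ 2) k)).
- by move=> k /=.
- by move=> k; rewrite mulr_ge0 ?invr_ge0 ?hg0// exp_coeff_ge0// sqr_ge0.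
- move=> k; have -> : exp_coeff (x ^+ 2) k = (x ^+ 2) ^+ k / k`!%:R by [].
  have xk : 0 <= (x ^+ 2) ^+ k by rewrite exprn_ge0// sqr_ge0.
  rewrite [X in X <= _]/= /bessel_coef !normrM normrX normrN1 expr1n mul1r.
  have -> : `|x ^+ k.*2| = (x ^+ 2) ^+ k.
    by rewrite -mul2n exprM ger0_norm.
  rewrite normfV ger0_norm ?mulr_ge0 ?hg0// invfM -mulrA mulrCA.
  rewrite (mulrC k`!%:R^-1) ler_pM ?invr_ge0 ?hg0 ?divr_ge0//.
  by rewrite lef_pV2 ?posrE ?half_gamma_gt0// half_gamma_ge.
- by apply: is_cvg_seriesZ; exact: is_cvg_series_exp_coeff.
Qed.

Lemma BesselJ_half L (x : R) : 0 < x ->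
  BesselJ (L.+1%:R / 2) x =
  (x / 2) `^ (L.+1%:R / 2) * limn (series (bessel_coef L.+2 (x / 2))).
Proof.
move=> x0; have x2 : 0 < x / 2 by rewrite divr_gt0.
rewrite /BesselJ (_ : (fun k : nat => _) =
  (fun k => (x / 2) `^ (L.+1%:R / 2) * bessel_coef L.+2 (x / 2) k)); last first.
  apply/funext => k; rewrite /bessel_coef.
  have -> : k%:R + L.+1%:R / 2 + 1 = (k.*2 + L.+1).+2%:R / 2 :> R.
    have -> : (k.*2 + L.+1).+2%:R = 2 * k%:R + L.+1%:R + 2 :> R.
      by rewrite -natrM -!natrD mul2n addn2.
    by field.
  have -> : 2 * k%:R + L.+1%:R / 2 = L.+1%:R / 2 + k.*2%:R :> R.
    by rewrite -mul2n natrM addrC.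
  rewrite Gamma_half powRD; last by rewrite (gt_eqF x2) implybT.
  by rewrite powR_mulrn ?ltW// -addnS; ring.
rewrite (_ : series _ = (fun n => (x / 2) `^ (L.+1%:R / 2) *
  series (bessel_coef L.+2 (x / 2)) n)); last first.
  by apply/funext => n; rewrite /series/= mulr_sumr.
apply/cvg_lim => //; apply: cvgM; first exact: cvg_cst.
exact: is_cvg_bessel_coef.
Qed.

End bessel.

(** * The characteristic function *)

Section characteristic_function.
Context {R : realType}.
Local Notation hg := (@half_gamma R).
Variables (d n : nat) (c t : R) (alpha : 'rV[R]_d.+2).
Hypotheses (hd : (2 <= d.+2)%N) (c0 : 0 < c) (t0 : 0 < t) (alpha0 : alpha != 0).

Let r := dot alpha alpha.
Let a := alpha 0 ord_max ^+ 2.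
Let A := (n.+1 * d.+3).-1.

Lemma dot_gt0 : 0 < r.
Proof.
have r0 : 0 <= r by apply: sumr_ge0 => i _; rewrite -expr2 sqr_ge0.
rewrite lt_neqAle r0 andbT eq_sym; apply: contra_neq alpha0 => rz.
apply/rowP => i; rewrite mxE; apply/eqP; rewrite -sqrf_eq0; apply/eqP.
have /psumr_eq0P : \sum_(i < d.+2) alpha 0 i ^+ 2 = 0.
  by rewrite -[RHS]rz /r /dot; apply: eq_bigr => k _; rewrite expr2.
by apply => // k _; rewrite sqr_ge0.
Qed.

(** The contribution of the term of index [j] of the binomial expansion to the
    expectation of the term of order [2 m] of the cosine series: the summand of index
    [m] of the power series of the [j]-th summand of the characteristic function. *)
Definition cf_term (j m : nat) : R :=
  (-1) ^+ m * ((c * t) ^+ m.*2 * (A`!%:R / (A + m.*2)`!%:R)) *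
  ('C(n.+1, j)%:R * (d.+3%:R * a) ^+ (n.+1 - j) *
   (if (m < n.+1 - j)%N then 0 else
    negbin ((n.+1 - j)%:R * (d.+3%:R / 2 + 1) + j%:R * (d.+3%:R / 2)) (m - (n.+1 - j)) *
    r ^+ (m - (n.+1 - j)))).

Let x := c * t * enorm alpha.

Let x_gt0 : 0 < x.
Proof. by rewrite !mulr_gt0// sqrtr_gt0 dot_gt0. Qed.

Let x_sqr k : x ^+ k.*2 = (c * t) ^+ k.*2 * r ^+ k.
Proof.
by rewrite /x exprMn -[in X in _ * X = _]mul2n exprM /enorm sqr_sqrtr// ltW// dot_gt0.
Qed.

(** The powers of 2 and of the variable that remain once the fractional ones cancel. *)
Lemma powR_half_quotient (y e : R) (B p : nat) : 0 < y ->
  e = (B + p.*2)%:R / 2 - p.*2%:R ->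
  (y / 2) `^ ((B + p.*2)%:R / 2) / y `^ e / 2 `^ (B%:R / 2) = y ^+ p.*2 / 2 ^+ (B + p).
Proof.
move=> y0 eE; set s := (B + p.*2)%:R / 2.
have pow0 (z u : R) : 0 < z -> z `^ u != 0 by move=> z0; rewrite gt_eqF// powR_gt0.
have powD (z u v : R) : 0 < z -> z `^ (u + v) = z `^ u * z `^ v.
  by move=> z0; rewrite powRD// (gt_eqF z0) implybT.
have yE : y `^ s = (y / 2) `^ s * 2 `^ s.
  by rewrite -powRM ?divr_ge0 ?ltW// divfK.
have y2E : y `^ s = y `^ e * y ^+ p.*2.
  by rewrite -powR_mulrn ?ltW// -powD// eE subrK.
have twoE : 2 `^ s * 2 `^ (B%:R / 2) = 2 ^+ (B + p) :> R.
  rewrite -powR_mulrn// -powD//; congr (_ `^ _).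
  by rewrite /s !natrD -mul2n natrM; field.
rewrite -twoE; have -> : (y / 2) `^ s = y `^ e * y ^+ p.*2 / 2 `^ s.
  by rewrite -y2E yE mulfK// pow0.
by field; rewrite !pow0.
Qed.

(** The terms of index less than [n + 1 - j] vanish; the others are, up to a common
    factor, those of a Bessel series. *)
Let cf_term_shift j k : (j <= n.+1)%N ->
  cf_term j (k + (n.+1 - j)) =
  Num.sqrt pi * A`!%:R * (x ^+ (n.+1 - j).*2 / 2 ^+ (A + (n.+1 - j))) *
  ((-1) ^+ (n.+1 - j) * 'C(n.+1, j)%:R *
    ((a / r * (d.+3%:R / 2)) ^+ (n.+1 - j) / hg (A + (n.+1 - j).*2))) *
  bessel_coef (A + (n.+1 - j).*2).+1 (x / 2) k.
Proof.
move=> jn; have N0 : 0 < n.+1%:R :> R by [].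
rewrite /cf_term; set p := (n.+1 - j)%N.
rewrite ltnNge leq_addl [~~ true]/= addnK.
have -> : p%:R * (d.+3%:R / 2 + 1) + j%:R * (d.+3%:R / 2) = (A + p.*2).+1%:R / 2 :> R.
  have -> : (A + p.*2).+1%:R = n.+1%:R * d.+3%:R + 2 * p%:R :> R.
    by rewrite -addSn /A prednK ?muln_gt0// natrD natrM -mul2n natrM.
  by rewrite /p natrB//; field.
have f0 i : i`!%:R != 0 :> R by rewrite pnatr_eq0 -lt0n fact_gt0.
have p0 : Num.sqrt pi != 0 :> R by rewrite gt_eqF// sqrtr_gt0 pi_gt0.
have r0 : r != 0 by rewrite gt_eqF// dot_gt0.
rewrite /bessel_coef /negbin.
have -> : \prod_(i < k) ((A + p.*2).+1%:R / 2 + i%:R) =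
    hg (A + p.*2 + k.*2) / hg (A + p.*2) :> R.
  by rewrite (half_gamma_shift (A + p.*2) k) [RHS]mulrC mulKf// half_gamma_neq0.
set M := (A + p.*2 + k.*2)%N.
have -> : (A + (k + p).*2 = M)%N by rewrite /M doubleD; lia.
have -> : (k.*2 + (A + p.*2).+1 = M.+1)%N by rewrite /M; lia.
have hM : hg M.+1 = Num.sqrt pi * M`!%:R / (2 ^+ M * hg M).
  apply: (mulfI (half_gamma_neq0 M)); rewrite half_gamma_duplication; field.
  by rewrite half_gamma_neq0 expf_neq0.
have twoM : (2 : R) ^+ M = 2 ^+ (A + p) * 2 ^+ p * 2 ^+ k.*2.
  by rewrite -!exprD; congr (_ ^+ _); rewrite /M; lia.
have -> : (-1) ^+ (k + p) = (-1) ^+ k * (-1) ^+ p :> R by rewrite exprD.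
have -> : (c * t) ^+ (k + p).*2 = (c * t) ^+ k.*2 * (c * t) ^+ p.*2.
  by rewrite doubleD exprD.
have -> : (x / 2) ^+ k.*2 = (c * t) ^+ k.*2 * r ^+ k / 2 ^+ k.*2.
  by rewrite exprMn x_sqr exprVn.
have -> : (d.+3%:R * a) ^+ p = d.+3%:R ^+ p * a ^+ p by rewrite exprMn.
have -> : (a / r * (d.+3%:R / 2)) ^+ p = a ^+ p / r ^+ p * (d.+3%:R ^+ p / 2 ^+ p).
  by rewrite !exprMn !exprVn.
rewrite x_sqr hM twoM; field.
by rewrite !expf_neq0 ?half_gamma_neq0 ?f0 ?p0.
Qed.

(** The series of index [j] sums to the [j]-th summand of the characteristic
    function. *)
Lemma cvg_cf_term j : (j <= n.+1)%N ->
  series (cf_term j) @ \oo -->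
  Num.sqrt pi * Gamma (n.+1 * d.+3)%:R / 2 `^ ((d.+3%:R * n.+1%:R - 1) / 2) *
  ((-1) ^+ (n.+1 - j) * 'C(n.+1, j)%:R *
    ((alpha 0 (last_ord hd) ^+ 2 / enorm alpha ^+ 2 * (d.+3%:R / 2)) ^+ (n.+1 - j)
      / Gamma (n.+1%:R * (d.+2%:R + 3) / 2 - j%:R)) *
    (BesselJ ((n.+1%:R * (d.+2%:R + 3) - (2 * j%:R + 1)) / 2) x
      / x `^ ((n.+1%:R * (d.+2%:R - 1) + 2 * j%:R - 1) / 2))).
Proof.
move=> jn; have B0 : (0 < A + (n.+1 - j).*2)%N by rewrite addn_gt0 /A mulSn.
have A1 : (A.+1%:R : R) = n.+1%:R * d.+3%:R by rewrite /A prednK ?muln_gt0// natrM.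
have shiftE := @cf_term_shift j ^~ jn.
have pE : (n.+1 - j)%:R = n.+1%:R - j%:R :> R by rewrite natrB.
move: shiftE B0 pE; set p := (n.+1 - j)%N; set B := (A + p.*2)%N => shiftE B0 pE.
have BE : B%:R = n.+1%:R * d.+3%:R - 1 + 2 * (n.+1%:R - j%:R) :> R.
  by rewrite -A1 -pE /B natrD -mul2n natrM -natr1; ring.
have -> : (d.+3%:R * n.+1%:R - 1) / 2 = A%:R / 2 :> R.
  by rewrite [d.+3%:R * _]mulrC -A1 -natr1 addrK.
have dE : d.+2%:R = d.+3%:R - 1 :> R by rewrite -[d.+3%:R]natr1 addrK.
have -> : n.+1%:R * (d.+2%:R + 3) / 2 - j%:R = B.-1.+2%:R / 2 :> R.
  by rewrite prednK// -[B.+1%:R]natr1 BE dE; field.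
have -> : (n.+1%:R * (d.+2%:R + 3) - (2 * j%:R + 1)) / 2 = B.-1.+1%:R / 2 :> R.
  by rewrite prednK// BE dE; field.
have -> : (n.+1%:R * (d.+2%:R - 1) + 2 * j%:R - 1) / 2 = B%:R / 2 - p.*2%:R :> R.
  by rewrite BE dE -mul2n natrM pE; field.
rewrite -[(n.+1 * d.+3)%N]prednK ?muln_gt0// Gamma_nat -/A Gamma_half.
rewrite BesselJ_half// !prednK//.
have -> : enorm alpha ^+ 2 = r by rewrite sqr_sqrtr// ltW// dot_gt0.
have -> : last_ord hd = ord_max by exact/val_inj.
rewrite -/a; set S := limn _.
have quot := powR_half_quotient (B := A) (p := p) x_gt0 (erefl (B%:R / 2 - p.*2%:R)).
rewrite -/B in quot.
pose Kc := Num.sqrt pi * A`!%:R * (x ^+ p.*2 / 2 ^+ (A + p)) *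
  ((-1) ^+ p * 'C(n.+1, j)%:R * ((a / r * (d.+3%:R / 2)) ^+ p / hg B)).
rewrite [X in _ --> X](_ : _ = Kc * S); last by rewrite /Kc -quot; ring.
apply: (cvg_from_shift (p := p) (v := fun k => Kc * series (bessel_coef B.+1 (x / 2)) k)).
  move=> k; rewrite /series/= !big_mkord addnC big_split_ord/=.
  rewrite big1 ?add0r => [|i _]; last by rewrite /cf_term ltn_ord !mulr0.
  by rewrite mulr_sumr; apply: eq_bigr => i _; rewrite addnC shiftE.
apply: cvgM; first exact: cvg_cst.
exact: is_cvg_bessel_coef.
Qed.

End characteristic_function.

Lemma cvg_finite_sum (R : realType) (I : Type) (s : seq I) (u : I -> nat -> R) (l : I -> R) :
  (forall i, u i n @[n --> \oo] --> l i) ->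
  \sum_(i <- s) u i n @[n --> \oo] --> \sum_(i <- s) l i.
Proof.
move=> ul; elim: s => [|i s IH].
  by under eq_fun do rewrite big_nil; rewrite big_nil; exact: cvg_cst.
by under eq_fun do rewrite big_cons; rewrite big_cons; apply: cvgD.
Qed.

Section random_flight_cf.
Context {R : realType} dT (T : measurableType dT) (P : probability T R).
Context (d n : nat) (c t : R) (c0 : 0 < c) (t0 : 0 < t).
Context (tau : {RV P >-> n.-tuple R}) (theta : 'I_n.+1 -> {RV P >-> (d.+1).-tuple R}).
Hypothesis hX : @random_flight R _ T P d.+2 n t tau theta.
Implicit Types alpha : 'rV[R]_d.+2.

(** The projection of the position on [alpha]. *)
Let Z alpha w := dot alpha (@position R _ T P d.+2 n c t tau theta w).

(** The event, of probability one, that the durations are positive. *)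
Let A := tau @^-1` [set s | admissible t s].

Let mA : measurable A.
Proof.
rewrite -[A]setTI; apply: (measurable_funPT tau) => //; exact: measurable_admissible.
Qed.

Let PA0 : P (~` A) = 0%E.
Proof.
apply: (density_support (flight_times hX) (measurable_admissible t)) => s /negP ns.
by rewrite times_densityE /simplex_monomial (negbTE ns) mulr0.
Qed.

Let mZ alpha : measurable_fun setT (Z alpha).
Proof.
rewrite (_ : Z alpha = fun w => c * \sum_k tnth (durations t (tau w)) k *
  dot alpha (@direction R d.+2 (theta k w))); last first.
  by apply/funext => w; exact: dot_position.
apply: measurable_funM => //; apply: measurable_sum => k; apply: measurable_funM.
  exact: (measurableT_comp (measurable_durations t k) (measurable_funPT tau)).
by have [] := bmeas_projection theta alpha k.
Qed.

Let Z_bound alpha : exists M, forall w, A w -> `|Z alpha w| <= M.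
Proof.
have [_ [M hM]] := bmeas_dot_direction alpha.
exists (c * \sum_(k < n.+1) t * M) => w Aw.
rewrite /Z dot_position normrM (gtr0_norm c0) ler_pM2l//.
rewrite (le_trans (ler_norm_sum _ _ _))// ler_sum// => k _.
have /andP[d0 dt] := admissible_durations k Aw.
by rewrite normrM ler_pM// ger0_norm.
Qed.

Let bZ alpha (h : R -> R) : measurable_fun setT h -> (forall x, `|h x| <= 1) ->
  bmeas (fun w => h (Z alpha w)).
Proof.
by move=> mh h1; split; [exact: measurableT_comp|exists 1 => w; exact: h1].
Qed.

Let measurable_cos' : measurable_fun setT (@cos R).
Proof. by apply: continuous_measurable_fun; exact: continuous_cos. Qed.

Let measurable_sin' : measurable_fun setT (@sin R).
Proof. by apply: continuous_measurable_fun; exact: continuous_sin. Qed.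

Let cos1 (x : R) : `|cos x| <= 1.
Proof. by rewrite ler_norml cos_geN1 cos_le1. Qed.

Let sin1 (x : R) : `|sin x| <= 1.
Proof. by rewrite ler_norml sin_geN1 sin_le1. Qed.

Lemma expectation_cos alpha : alpha != 0 ->
  series (fun k => \sum_(j < n.+2) cf_term n c t alpha j k) @ \oo -->
  \int[P]_w cos (Z alpha w).
Proof.
move=> alpha0; have [M ZM] := Z_bound alpha.
rewrite (expectation_indic_full mA PA0 (bZ alpha measurable_cos' cos1)).
have cosE (x : R) : series (fun k => (-1) ^+ k * divided_pow x (k.*2 + 0)) @ \oo --> cos x.
  rewrite (_ : (fun k => _) = cos_coeff' x); first exact: cvg_cos_coeff'.
  by apply/funext => k; rewrite addn0 /cos_coeff' mulrA.
rewrite (_ : (fun k => _) = fun k => (-1) ^+ k *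
  \int[P]_w (\1_A w * divided_pow (Z alpha w) (k.*2 + 0))).
  exact: (cvg_expectation_series (P := P) mA (mZ alpha) ZM (leq0n 1) measurable_cos' cosE).
apply/funext => k; rewrite addn0.
rewrite (flight_moment c t0 hX alpha k.*2) odd_double doubleK coef_projection_exp.
by rewrite !mulr_sumr; apply: eq_bigr => j _; rewrite /cf_term !mulrA.
Qed.

Lemma expectation_sin alpha : \int[P]_w sin (Z alpha w) = 0.
Proof.
have [M ZM] := Z_bound alpha.
rewrite (expectation_indic_full mA PA0 (bZ alpha measurable_sin' sin1)).
have sinE (x : R) : series (fun k => (-1) ^+ k * divided_pow x (k.*2 + 1)) @ \oo --> sin x.
  rewrite (_ : (fun k => _) = sin_coeff' x); first exact: cvg_sin_coeff'.
  by apply/funext => k; rewrite addn1 /sin_coeff' mulrA.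
have h := cvg_expectation_series (P := P) mA (mZ alpha) ZM (leqnn 1) measurable_sin' sinE.
apply: (cvg_unique _ h) => //.
rewrite (_ : series _ = fun=> 0); first exact: cvg_cst.
apply/funext => m; rewrite /series/= big1// => k _.
by rewrite (flight_moment c t0 hX alpha (k.*2 + 1)) addn1 /= odd_double/= !mulr0.
Qed.

Lemma expectation_cos_flight_cf (hd : (2 <= d.+2)%N) alpha : alpha != 0 ->
  \int[P]_w cos (Z alpha w) = flight_cf hd n c t alpha.
Proof.
move=> alpha0; apply: (cvg_unique _ (expectation_cos alpha0)) => //.
rewrite /flight_cf mulr_sumr.
rewrite (_ : series _ = fun m => \sum_(j < n.+2) series (cf_term n c t alpha j) m).
  by apply: cvg_finite_sum => j; apply: cvg_cf_term => //; rewrite -ltnS.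
by apply/funext => m; rewrite /series/= exchange_big.
Qed.

(** The characteristic function is continuous at the origin. *)
Lemma expectation_cos_cvg0 :
  \int[P]_w cos (Z alpha w) @[alpha --> (0 : 'rV[R]_d.+2)^'] --> (1 : R).
Proof.
have cosB1 (z : R) : `|cos z - 1| <= `|z|.
  wlog z0 : z / 0 <= z => [h|].
    by case: (leP 0 z) => [/h //|/ltW z0]; rewrite -cosN -[`|z|]normrN h// oppr_ge0.
  have [x _ e] := MVT_segment z0 (fun x _ => is_derive_cos x)
    (continuous_subspaceT (@continuous_cos R)).
  by rewrite -cos0 e subr0 normrM ler_piMl// normrN.
have /choice[M hM] : forall i : 'I_d.+2, exists m, forall w, A w ->
    `|Z (delta_mx 0 i) w| <= m by move=> i; exact: Z_bound.
(* [Z] is linear in [alpha], so bounds for the coordinates of the position suffice *)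
pose B := \sum_i `|M i|.
have ZB alpha w : A w -> `|Z alpha w| <= `|alpha| * B.
  move=> Aw; have -> : Z alpha w = \sum_i alpha 0 i * Z (delta_mx 0 i) w.
    apply: eq_bigr => i _; congr (_ * _); rewrite /Z /dot (bigD1 i)//= big1 ?addr0.
      by rewrite [delta_mx _ _ _ _]mxE !eqxx mul1r.
    by move=> k ki; rewrite [delta_mx _ _ _ _]mxE eqxx (negbTE ki) mul0r.
  rewrite (le_trans (ler_norm_sum _ _ _))// /B mulr_sumr ler_sum// => i _.
  rewrite normrM ler_pM//; last by rewrite (le_trans (hM i w Aw))// ler_norm.
  rewrite [leRHS]mx_normrE.
  exact: (le_bigmax _ (fun ij : 'I_1 * 'I_d.+2 => `|alpha ij.1 ij.2|) (0, i)).
have B0 : 0 <= B by apply: sumr_ge0.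
have key alpha : `|\int[P]_w cos (Z alpha w) - 1| <= `|alpha| * B.
  have bc := bZ alpha measurable_cos' cos1.
  have b1 : bmeas (fun w => cos (Z alpha w) - 1) by apply: bmeasB => //; exact: bmeas_cst.
  have -> : \int[P]_w cos (Z alpha w) - 1 = \int[P]_w (\1_A w * (cos (Z alpha w) - 1)).
    rewrite -(expectation_indic_full mA PA0 b1) RintegralB//.
    - rewrite [X in _ = _ - X]/Rintegral integral_cst// mul1e.
      by rewrite [X in _ - fine X]probability_setT.
    - exact: bmeas_integrable.
    - by apply: bmeas_integrable; exact: bmeas_cst.
  have b2 : bmeas (fun w => \1_A w * (cos (Z alpha w) - 1)).
    by apply: bmeasM => //; exact: bmeas_indic.
  have ib2 := bmeas_integrable P b2.
  rewrite (le_trans (le_normr_Rintegral measurableT ib2))//.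
  have -> : `|alpha| * B = \int[P]_w (`|alpha| * B).
    by rewrite /Rintegral integral_cst// [X in fine (_ * X)]probability_setT mule1.
  apply: le_Rintegral => //.
  - exact: integrable_norm.
  - by apply: bmeas_integrable; exact: bmeas_cst.
  move=> w _; rewrite indicE; case: (boolP (w \in A)) => [/set_mem Aw|_].
    by rewrite mul1r (le_trans (cosB1 _))// ZB.
  by rewrite mul0r normr0 mulr_ge0.
apply/cvgrPdist_le => e e0; near=> b.
rewrite distrC (le_trans (key b))// (@le_trans _ _ (e / (B + 1) * B))//.
  rewrite ler_wpM2r//; near: b; apply: dnbhs0_le.
  by rewrite divr_gt0// ltr_wpDl.
rewrite mulrAC ler_pdivrMr ?ltr_wpDl// ler_pM2l// lerDl//.
Unshelve. all: by end_near. Qed.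

End random_flight_cf.

Theorem theorem3 (R : realType) (dT : measure_display) (T : measurableType dT)
    (P : probability T R) (d n : nat) (hd : (2 <= d)%N) (hn : (1 <= n)%N)
    (c t : R) (hc : 0 < c) (ht : 0 < t)
    (tau : {RV P >-> n.-tuple R}) (theta : 'I_n.+1 -> {RV P >-> (d.-1).-tuple R})
    (hX : random_flight t tau theta) (alpha : 'rV[R]_d) :
  let E := cexpectation P (fun w => expi (dot alpha (position c t tau theta w))) in
  (alpha != 0 -> E = (flight_cf hd n c t alpha)%:C%C) /\
  (alpha = 0 -> exists2 l : R,
     flight_cf hd n c t b @[b --> (0 : 'rV[R]_d)^'] --> l & E = l%:C%C).
Proof.
case: d hd theta hX alpha => [|[|d]]// hd theta hX alpha E.
have EE : E = Complex (\int[P]_w cos (dot alpha (position c t tau theta w))) 0.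
  by rewrite /E /cexpectation /= (expectation_sin hc ht hX).
split=> alpha0.
  by rewrite EE (expectation_cos_flight_cf hc ht hX hd alpha0).
exists 1; last first.
  rewrite EE; congr Complex; transitivity (\int[P]_w (1 : R)).
    apply: eq_Rintegral => w _; rewrite /dot big1 ?cos0// => i _.
    by rewrite alpha0 mxE mul0r.
  by rewrite /Rintegral integral_cst// mul1e [X in fine X]probability_setT.
apply: cvg_trans (expectation_cos_cvg0 hc hX).
apply: near_eq_cvg; near=> b.
rewrite (expectation_cos_flight_cf hc ht hX hd)//.
near: b; exact: nbhs_dnbhs_neq.
Unshelve. all: by end_near. Qed.
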